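(* For all quadruples $\vec\xi=(\theta,v,u,w)\in(A(BC))^\vee\times A\times B\times C$, $\vec\xi'=(\theta',v,u,w)\in((AB)C)^\vee\times A\times B\times C$ and all $h,k$, the series $F^{A(BC)}_{h,k}(\vec\xi;x,y)=\langle\theta,\mathcal Y_h^{A(BC)}(v,x)\mathcal Y_k^{BC}(u,y)w\rangle$ and $F^{(AB)C}_{h,k}(\vec\xi';x-y,y)=\langle\theta',\mathcal Y_h^{(AB)C}(\mathcal Y_k^{AB}(v,x-y)u,y)w\rangle$ are locally normally convergent on $\{(x,y)\in\mathbb C^2\mid0<|y|<|x|\}$ and $\{(x,y)\in\mathbb C^2\mid0<|x-y|<|y|\}$, respectively.
   Context: $V$ is a vertex operator algebra over $\mathbb C$; $\alpha_n$ denotes the modes, $Y(\alpha,z)=\sum_{n\in\mathbb Z}\alpha_nz^{-n-1}$. A $V$-module $W$ is $\mathbb N$-gradable if $W=\bigoplus_{m\in\mathbb N}W_{(m)}$ with $\alpha_kW_{(m)}\subseteq W_{(m+\mathrm{wt}(\alpha)-k-1)}$ for homogeneous $\alpha$. $W$ is $C_1$-cofinite if $\dim W/C_1(W)<\infty$, where $C_1(W)=\mathrm{span}\{\alpha_{-1}w\mid w\in W,\alpha\in V,\mathrm{wt}(\alpha)\ge1\}$. $W^\vee=\bigoplus_m\mathrm{Hom}(W_{(m)},\mathbb C)$ is the contragredient module. A logarithmic intertwining operator of type $\binom{C}{A\ B}$ is a linear assignment $v\mapsto\mathcal Y(v,z)=\sum_{h=0}^K\mathcal Y_h(v,z)\log^h(z)$,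 $\mathcal Y_h(v,z)=\sum_{s\in\mathbb C}v_{s,h}z^{-s-1}$, $v_{s,h}\in\mathrm{Hom}(B,C)$ (lower truncated), satisfying (I1) $\alpha_m\mathcal Y(v,z)u-\mathcal Y(v,z)\alpha_mu=\sum_{j\ge0}\binom mj\mathcal Y(\alpha_jv,z)u\,z^{m-j}$; (I2) $\mathcal Y(\alpha_mv,z)u=\sum_{j\ge0}\binom mj(-1)^j\{\alpha_{m-j}z^j\mathcal Y(v,z)u-(-1)^m\mathcal Y(v,z)\alpha_jz^{m-j}u\}$; (I3) $\mathcal Y(L(-1)v,z)u=\frac{d}{dz}\mathcal Y(v,z)u$. The fusion product $(A\boxtimes B,\mathcal Y^{AB})$ is the universal pair of an $\mathbb N$-gradable module and a logarithmic intertwining operator of type $\binom{A\boxtimes B}{A\ B}$ (every logarithmic intertwining operator from $A,B$ to an $\mathbb N$-gradable module factors uniquely through it by a $V$-homomorphism); for $C_1$-cofinite $\mathbb N$-gradable $A,B$ it exists and is again $C_1$-cofinite $\mathbb N$-gradable. $A,B,C$ are $C_1$-cofinite $\mathbb N$-gradable $V$-modules, $A(BC)=A\boxtimes(B\boxtimes C)$, $(AB)C=(A\boxtimes B)\boxtimes C$, with fusion operators $\mathcal Y^{A(BC)},\mathcal Y^{BC},\mathcal Y^{(AB)C},\mathcal Y^{AB}$, and subscripts $h,k$ denote the coefficients of $\log^h,\log^k$ in them. The series $F^{A(BC)}_{h,k}$ is a series of monomials $x^ay^b$ and $F^{(AB)C}_{h,k}$ one of monomials $(x-y)^ay^b$,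 with complex exponents; local normal convergence is convergence of the sum of sup-norms of the terms near every point, for (local) branches of these monomials. *)

(* Defs.v *)
(* The field of complex numbers is [R[i]], for
   [R : realType]; its topology is the one carried by [R[i]^o]. *)
From HB Require Import structures.
From mathcomp Require Import all_boot all_order all_algebra.
From mathcomp Require Import complex.
From mathcomp Require Import all_classical all_reals all_analysis.

Set Implicit Arguments.
Unset Strict Implicit.
Unset Printing Implicit Defensive.

Import Order.TTheory GRing.Theory Num.Theory.
Import numFieldNormedType.Exports.

Local Open Scope classical_set_scope.
Local Open Scope complex_scope.
Local Open Scope ring_scope.

Section LinearAlgebra.
Variables (K : fieldType) (W : lmodType K).

Definition subspace (S : set W) : Prop :=
  S 0 /\ forall (a : K) (x y : W), S x -> S y -> S (a *: x + y).

Definition lspan (S : set W) : set W :=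
  [set w | exists (n : nat) (a : 'I_n -> K) (f : 'I_n -> W),
      (forall i, S (f i)) /\ w = \sum_(i < n) a i *: f i].

Definition finite_dim (S : set W) : Prop :=
  exists s : seq W, S `<=` lspan [set x | x \in s].

(* dim W / S < oo, for a subspace S: the classes of the members of s span *)
Definition finite_codim (S : set W) : Prop :=
  exists s : seq W, forall w,
    exists2 x, lspan [set x | x \in s] x & S (w - x).

Definition direct_sum (I : choiceType) (P : I -> set W) : Prop :=
  [/\ forall i, subspace (P i),
      forall w, exists (s : seq I) (f : I -> W),
        [/\ uniq s, forall i, P i (f i) & w = \sum_(i <- s) f i]
    & forall (s : seq I) (f : I -> W),
        uniq s -> (forall i, P i (f i)) -> \sum_(i <- s) f i = 0 ->
        forall i, i \in s -> f i = 0].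

End LinearAlgebra.

Definition binz (K : fieldType) (m : int) (j : nat) : K :=
  (\prod_(i < j) (m - i%:Z)%:~R) / j`!%:R.

(* [vmode a n b] is a_n b.  The sums over nat in the Borcherds identity are
   finitely supported, by truncation. *)
Record voa (R : realType) := Voa {
  vcarrier :> lmodType R[i];
  vmode : vcarrier -> int -> vcarrier -> vcarrier;
  vvac : vcarrier;
  vconf : vcarrier;
  vgr : int -> set vcarrier;
  vcharge : R[i];
  vmode_linearl : forall n b, linear (fun a => vmode a n b);
  vmode_linearr : forall a n, linear (vmode a n);
  vmode_trunc : forall a b, exists N : int,
    forall n : int, N <= n -> vmode a n b = 0;
  vvac_mode : forall (n : int) b, vmode vvac n b = if n == -1 then b else 0;
  vcreation : forall a, vmode a (-1) vvac = a /\
    forall n : nat, vmode a n%:Z vvac = 0;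
  vborcherds : forall a b c (l m n : int),
    \sum_(j \in [set: nat])
      binz R[i] m j *: vmode (vmode a (l + j%:Z) b) (m + n - j%:Z) c
    = \sum_(j \in [set: nat]) ((-1) ^+ j * binz R[i] l j) *:
        (vmode a (l + m - j%:Z) (vmode b (n + j%:Z) c)
         - (-1) ^ l *: vmode b (l + n - j%:Z) (vmode a (m + j%:Z) c));
  (* L(n) is the mode of index n + 1 of the conformal vector *)
  vvirasoro : forall (m n : int) b,
    vmode vconf (m + 1) (vmode vconf (n + 1) b)
    - vmode vconf (n + 1) (vmode vconf (m + 1) b)
    = (m - n)%:~R *: vmode vconf (m + n + 1) b
      + (if m + n == 0 then ((m ^+ 3 - m)%:~R / 12%:R * vcharge) *: b else 0);
  vderiv : forall a (n : int) b,
    vmode (vmode vconf 0 a) n b = (- n)%:~R *: vmode a (n - 1) b;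
  vgr_sum : direct_sum vgr;
  vgr_wt : forall (n : int) a, vgr n a -> vmode vconf 1 a = n%:~R *: a;
  vgr_findim : forall n, finite_dim (vgr n);
  vgr_bounded : exists N : int,
    forall (n : int) a, n < N -> vgr n a -> a = 0;
  vgr_vac : vgr 0 vvac;
  vgr_conf : vgr 2 vconf }.

Record vmodule (R : realType) (V : voa R) := VModule {
  mcarrier :> lmodType R[i];
  mmode : V -> int -> mcarrier -> mcarrier;
  mmode_linearl : forall n w, linear (fun a => mmode a n w);
  mmode_linearr : forall a n, linear (mmode a n);
  mmode_trunc : forall a w, exists N : int,
    forall n : int, N <= n -> mmode a n w = 0;
  mvac_mode : forall (n : int) w,
    mmode (vvac V) n w = if n == -1 then w else 0;
  mborcherds : forall (a b : V) w (l m n : int),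
    \sum_(j \in [set: nat])
      binz R[i] m j *: mmode (vmode a (l + j%:Z) b) (m + n - j%:Z) w
    = \sum_(j \in [set: nat]) ((-1) ^+ j * binz R[i] l j) *:
        (mmode a (l + m - j%:Z) (mmode b (n + j%:Z) w)
         - (-1) ^ l *: mmode b (l + n - j%:Z) (mmode a (m + j%:Z) w)) }.

Section Modules.
Variables (R : realType) (V : voa R).
Implicit Types A B D W : vmodule V.

(* W_(n) for n : int, with W_(n) = 0 for n < 0 *)
Definition gr_int W (g : nat -> set W) (n : int) : set W :=
  match n with Posz m => g m | Negz _ => [set 0] end.

Definition is_grading W (g : nat -> set W) : Prop :=
  direct_sum g /\
  forall (d : int) (a : V) (k : int) (m : nat) (w : W),
    vgr d a -> g m w -> gr_int g (m%:Z + d - k - 1) (mmode a k w).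

Definition N_gradable W : Prop := exists g : nat -> set W, is_grading g.

(* The sum of the Hom(W_(m), C), as a subspace of the full dual of W: the
   linear forms which vanish on all but finitely many W_(m). *)
Definition contragredient W (g : nat -> set W) : set {scalar W} :=
  [set theta | exists M : nat, forall m w, (M <= m)%N -> g m w -> theta w = 0].

Definition C1 W : set W :=
  lspan [set x | exists (n : int) (a : V) (w : W),
           [/\ 1 <= n, vgr n a & x = mmode a (-1) w]].

Definition C1_cofinite W : Prop := finite_codim (@C1 W).

Definition vhom A B (f : A -> B) : Prop :=
  linear f /\ forall a n w, f (mmode a n w) = mmode a n (f w).

(* [Y h v s u] is v_{s,h} u, the coefficient of z^(-s-1) log^h(z) in
   Y(v,z)u; lio_comm, lio_iter and lio_deriv are (I1), (I2) and (I3), read off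
   at z^(-s-1) log^h(z). *)
Record log_intertwiner A B D := LogIntertwiner {
  lio :> nat -> A -> R[i] -> B -> D;
  lio_linearl : forall h s u, linear (fun v => lio h v s u);
  lio_linearr : forall h v s, linear (lio h v s);
  lio_log : exists K : nat, forall h v s u, (K < h)%N -> lio h v s u = 0;
  lio_trunc : forall v u, exists N : R, forall h s,
    N <= complex.Re s -> lio h v s u = 0;
  lio_comm : forall (a : V) (m : int) h v s u,
    mmode a m (lio h v s u) - lio h v s (mmode a m u)
    = \sum_(j \in [set: nat])
        binz R[i] m j *: lio h (mmode a j%:Z v) (s + m%:~R - j%:R) u;
  lio_iter : forall (a : V) (m : int) h v s u,
    lio h (mmode a m v) s u
    = \sum_(j \in [set: nat]) (binz R[i] m j * (-1) ^+ j) *: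
        (mmode a (m - j%:Z) (lio h v (s + j%:R) u)
         - (-1) ^ m *: lio h v (s + m%:~R - j%:R) (mmode a j%:Z u));
  lio_deriv : forall h v s u,
    lio h (mmode (vconf V) 0 v) s u
    = (- s) *: lio h v (s - 1) u + h.+1%:R *: lio h.+1 v (s - 1) u }.

Definition is_fusion_product A B P (Y : log_intertwiner A B P) : Prop :=
  N_gradable P /\
  forall D (I : log_intertwiner A B D), N_gradable D ->
    exists! f : P -> D, vhom f /\ forall h v s u, f (Y h v s u) = I h v s u.

End Modules.

Section Convergence.
Variable R : realType.
Local Notation CC := (R[i])^o.
Local Notation C2 := (CC * CC)%type.

Definition cexp (z : R[i]) : R[i] :=
  (expR (complex.Re z))%:C * (cos (complex.Im z) +i* sin (complex.Im z)).

(* l is a branch of the logarithm of the function X near p *)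
Definition log_branch (X : C2 -> CC) (p : C2) (l : C2 -> CC) : Prop :=
  \forall q \near p, cexp (l q) = X q /\ {for q, continuous l}.

Definition normally_convergent (J : choiceType) (U : set C2)
    (f : J -> C2 -> CC) : Prop :=
  (\esum_(j in [set: J]) ereal_sup [set (Normc.normc (f j q))%:E | q in U]
     < +oo)%E.

(* The series is the sum over all exponents a, b of c a b * X^a * Y^b.  A
   branch of a monomial near p is given by branches lX, lY of log X and log Y,
   the same ones for all exponents: X^a = exp(a lX) and Y^b = exp(b lY). *)
Definition locally_normally_convergent (c : R[i] -> R[i] -> R[i])
    (X Y : C2 -> CC) (D : set C2) : Prop :=
  forall (p : C2) (lX lY : C2 -> CC),
    D p -> log_branch X p lX -> log_branch Y p lY ->
    exists2 U : set C2, nbhs p U &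
      normally_convergent U (fun (ab : R[i] * R[i]) q =>
        c ab.1 ab.2 * cexp (ab.1 * lX q) * cexp (ab.2 * lY q)).

End Convergence.

Section Series.
Variables (R : realType) (V : voa R).

(* <theta, Y1_h(v,x) Y2_k(u,y) w>: the coefficient of x^a y^b *)
Definition F_product (A B C BC P : vmodule V) (Y1 : log_intertwiner A BC P)
    (Y2 : log_intertwiner B C BC) (h k : nat) (theta : {scalar P})
    (v : A) (u : B) (w : C) (a b : R[i]) : R[i] :=
  theta (Y1 h v (- a - 1) (Y2 k u (- b - 1) w)).

(* <theta, Y1_h(Y2_k(v,x-y)u,y) w>: the coefficient of (x-y)^a y^b *)
Definition F_iterate (A B C AB P : vmodule V) (Y1 : log_intertwiner AB C P)
    (Y2 : log_intertwiner A B AB) (h k : nat) (theta : {scalar P})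
    (v : A) (u : B) (w : C) (a b : R[i]) : R[i] :=
  theta (Y1 h (Y2 k v (- a - 1) u) (- b - 1) w).

End Series.

(* Main.v *)
Require Import Defs.
From HB Require Import structures.
From mathcomp Require Import all_boot all_order all_algebra.
From mathcomp Require Import complex.
From mathcomp Require Import all_classical all_reals all_analysis.
From mathcomp Require Import zify ring lra.

Set Implicit Arguments.
Unset Strict Implicit.
Unset Printing Implicit Defensive.

Import Order.TTheory GRing.Theory Num.Theory.
Import numFieldNormedType.Exports.

Local Open Scope classical_set_scope.
Local Open Scope complex_scope.
Local Open Scope ring_scope.

(** Write the monomials of the series as [large^a * small^b], where (large,
    small) is (x, y) for the product and (y, x - y) for the iterate, and put
    [t := small / large] and [r := a + b].  The series converge on [|t| < 1]
    because they solve a differential equation in [t] with a regular singular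
    point at [t = 0] and no other singularity in the disc.

    The equation comes from C1-cofiniteness.  By (I1) and (I2) a mode [a_{-1}]
    of an element of positive weight, acting on one of the three vectors, can be
    moved to the other two, on which it acts by modes [a_j] with [j >= 0], and to
    the linear form, which it composes with modes [a_{-1-n}].  The first kind of
    terms has lower total degree of the vectors; its coefficients are products of
    powers of the inverse differences of the three insertion points, hence
    elements of [C[t, (1 - s t)^-1]] once the correlator is multiplied by small to
    the power of its total degree, with [s = 1] for the product and [s = -1] for
    the iterate.  The second kind has a linear form of lower degree and is known
    to converge by induction.  So, modulo convergent series, the correlators span
    a finitely generated module over this ring ([C1_generators],
    [reducible_good]), which is stable under differentiation, because derivatives
    are insertions of [L(-1)] by (I3).  Coefficients of higher powers of the
    logarithms enter the derivatives as further inhomogeneous terms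
    ([contragredient_log_ind]).

    Two derivatives are available: [small * d/dsmall] acts regularly, while the
    total Euler operator, which multiplies by [r], only does so after
    multiplication by [t].  The first bounds the exponents [b] and the growth of
    the coefficients by Frobenius' method; the second shows that finitely many
    [r] occur, being the eigenvalues of a matrix over [C(t)]
    ([frobenius_total], [frobenius_small], [frobenius_growth]).  The series is
    thus a finite sum of power series in [t] times monomials, each dominated by a
    geometric series near any point with [|t| < 1]
    ([good_normally_convergent]). *)

(** * Real parts, norms and descent *)

Section ComplexFacts.
Variable R : realType.
Implicit Types z w : R[i].
Local Notation normc := (@Normc.normc R).

Lemma ReD z w : complex.Re (z + w) = complex.Re z + complex.Re w.
Proof. by case: z w => [a b] [c d]. Qed.

Lemma ReN z : complex.Re (- z) = - complex.Re z.
Proof. by case: z. Qed.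

Lemma ReB z w : complex.Re (z - w) = complex.Re z - complex.Re w.
Proof. by rewrite ReD ReN. Qed.

Lemma Re_nat n : complex.Re (n%:R : R[i]) = n%:R.
Proof. by elim: n => [|n IH] //; rewrite -natr1 ReD IH /= natr1. Qed.

Lemma normc_ge0 z : 0 <= normc z.
Proof. by case: z => a b /=; rewrite sqrtr_ge0. Qed.

Lemma ler_Re_normc z : complex.Re z <= normc z.
Proof.
case: z => a b /=; apply: (le_trans (ler_norm a)).
by rewrite -sqrtr_sqr ler_wsqrtr // lerDl sqr_ge0.
Qed.

Lemma ler_normc_sum I (s : seq I) (P : pred I) (F : I -> R[i]) :
  normc (\sum_(i <- s | P i) F i) <= \sum_(i <- s | P i) normc (F i).
Proof.
elim/big_ind2: _ => //; first by rewrite Normc.normc0.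
by move=> x x' y y' h h'; apply: (le_trans (le_normcD _ _)); rewrite lerD.
Qed.

Lemma exists_bound_seq (T : eqType) (s : seq T) (f : T -> R) :
  exists2 K, 0 <= K & forall x, x \in s -> f x <= K.
Proof.
elim: s => [|x s [K K0 hK]]; first by exists 0.
exists (Num.max K (f x)); first by rewrite le_max K0.
move=> y; rewrite inE => /orP[/eqP->|/hK h]; first by rewrite le_max lexx orbT.
by rewrite le_max h.
Qed.

(** Strong induction along the arithmetic progressions [b, b - 1, b - 2, ...],
    started by the vanishing far to the left. *)
Lemma descent (Q : R[i] -> Prop) (N : R) :
  (forall b, complex.Re b < N -> Q b) ->
  (forall b, (forall m : nat, Q (b - m.+1%:R)) -> Q b) ->
  forall b, Q b.
Proof.
move=> Q0 QS.
have H n : forall b, complex.Re b < N + n%:R -> Q b.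
  elim: n => [|n IH] b; first by rewrite addr0 => /Q0.
  move=> hb; apply: QS => m; apply: IH; rewrite ReB Re_nat.
  have : (0 : R) <= m%:R by [].
  rewrite -natr1 in hb; rewrite -natr1; lra.
move=> b; apply: (H (Num.Def.truncn `|complex.Re b - N|).+1).
have := truncnS_gt `|complex.Re b - N|.
have := ler_norm (complex.Re b - N).
lra.
Qed.

End ComplexFacts.
Arguments descent {R} Q N.

(** * Families of coefficients *)

Section Families.
Variable R : realType.
Local Notation CC := (R[i]).
Local Notation normc := (@Normc.normc R).
Local Notation Re := (@complex.Re R).
Local Notation fam := (CC -> CC -> CC).
Implicit Types (c x y g : fam) (r b : CC) (p q : {poly CC}).

Definition trunc c : Prop := exists N : R, forall r b, Re b < N -> c r b = 0.

(** A family [c] stands for the formal sum of the terms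
    [c r b * large^(r - b) * small^b].  Multiplication by [t := small / large]
    keeps the total exponent [r] and raises [b] by one; this is the action of
    ['X]. *)
Definition pact p c : fam := fun r b =>
  \sum_(i < size p) p`_i * c r (b - i%:R).

Lemma pact_wide p c n r b : (size p <= n)%N ->
  pact p c r b = \sum_(i < n) p`_i * c r (b - i%:R).
Proof.
move=> pn; rewrite /pact -!(big_mkord xpredT (fun i => p`_i * c r (b - i%:R))).
rewrite (@big_cat_nat _ _ _ (size p) 0 n) //=.
rewrite [X in _ = _ + X]big1_seq ?addr0 // => i.
by rewrite mem_index_iota => /andP[_ /andP[h _]]; rewrite nth_default ?mul0r.
Qed.

Lemma pactDl p q c r b : pact (p + q) c r b = pact p c r b + pact q c r b.
Proof.
pose n := maxn (size (p + q)) (maxn (size p) (size q)).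
rewrite !(@pact_wide _ _ n) ?leq_max ?leqnn ?orbT //.
by rewrite -big_split; apply: eq_bigr => i _; rewrite coefD mulrDl.
Qed.

Lemma pact0 c r b : pact 0 c r b = 0.
Proof. by rewrite /pact size_poly0 big_ord0. Qed.

Lemma pactZl a p c r b : pact (a *: p) c r b = a * pact p c r b.
Proof.
pose n := maxn (size (a *: p)) (size p).
rewrite !(@pact_wide _ _ n) ?leq_max ?leqnn ?orbT //.
by rewrite mulr_sumr; apply: eq_bigr => i _; rewrite coefZ mulrA.
Qed.

Lemma pactNl p c r b : pact (- p) c r b = - pact p c r b.
Proof. by rewrite -scaleN1r pactZl mulN1r. Qed.

Lemma pact_suml n (p : 'I_n -> {poly CC}) c r b :
  pact (\sum_i p i) c r b = \sum_i pact (p i) c r b.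
Proof.
apply: (big_morph (fun p => pact p c r b)) => [p1 p2|]; last exact: pact0.
exact: pactDl.
Qed.

Lemma pactC a c r b : pact a%:P c r b = a * c r b.
Proof.
rewrite (@pact_wide _ _ 1) ?size_polyC ?leq_b1 //.
by rewrite big_ord1 coefC eqxx subr0.
Qed.

Lemma pactMX p c r b : pact (p * 'X) c r b = pact p c r (b - 1).
Proof.
pose n := maxn (size (p * 'X)) (size p).
rewrite (@pact_wide _ _ n.+1) ?(@pact_wide _ _ n) ?leqW ?leq_max ?leqnn ?orbT //.
rewrite big_ord_recl /= coefMX eqxx mul0r add0r; apply: eq_bigr => i _.
rewrite coefMX /= /bump /= add1n; congr (_ * c _ _).
by rewrite -[in LHS]nat1r opprD addrA.
Qed.

Lemma pactX c r b : pact 'X c r b = c r (b - 1).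
Proof. by rewrite -[X in pact X]mul1r pactMX pactC mul1r. Qed.

Lemma pactM p q c r b : pact (p * q) c r b = pact p (pact q c) r b.
Proof.
elim/poly_ind: p b => [|p a IH] b; first by rewrite mul0r !pact0.
rewrite mulrDl !pactDl mulrAC !pactMX IH; congr (_ + _).
by rewrite mul_polyC pactZl pactC.
Qed.

(* the action at [r] only sees [c r] *)
Lemma eq_pact p x y r : (forall b, x r b = y r b) ->
  forall b, pact p x r b = pact p y r b.
Proof. by move=> h b; apply: eq_bigr => i _; rewrite h. Qed.

Lemma eq_pactf p x y : (forall r b, x r b = y r b) ->
  forall r b, pact p x r b = pact p y r b.
Proof. by move=> h r b; apply: eq_pact. Qed.

Lemma pactDr p x y r b :
  pact p (fun r b => x r b + y r b) r b = pact p x r b + pact p y r b.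
Proof. by rewrite -big_split; apply: eq_bigr => i _; rewrite mulrDr. Qed.

Lemma pactZr p (k : CC -> CC) x r b :
  pact p (fun r b => k r * x r b) r b = k r * pact p x r b.
Proof. by rewrite mulr_sumr; apply: eq_bigr => i _; rewrite mulrCA. Qed.

Lemma pact_sumr p I (s : seq I) (x : I -> fam) r b :
  pact p (fun r b => \sum_(i <- s) x i r b) r b = \sum_(i <- s) pact p (x i) r b.
Proof.
rewrite /pact exchange_big; apply: eq_bigr => i _.
by rewrite mulr_sumr.
Qed.

Lemma pact_first p x r b : (forall m : nat, x r (b - m.+1%:R) = 0) ->
  pact p x r b = p`_0 * x r b.
Proof.
move=> h; rewrite (@pact_wide _ _ (size p).+1) // big_ord_recl subr0 big1 ?addr0 //.
by move=> i _; rewrite lift0 h mulr0.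
Qed.

Lemma trunc_pact p x : trunc x -> trunc (pact p x).
Proof.
move=> [N h]; exists N => r b hb; rewrite /pact big1 // => i _.
by rewrite h ?mulr0 // ReB Re_nat; have : (0:R) <= i%:R by []; lra.
Qed.

(** Truncated families form a torsion-free module: the lowest coefficient of
    [p] expresses [x r b] through the [x r (b - j)] with [j > 0]. *)
Lemma pact_inj p x r : trunc x -> p != 0 ->
  (forall b, pact p x r b = 0) -> forall b, x r b = 0.
Proof.
move=> [N xN] p0 h.
have [m pm hm] : exists2 m, p`_m != 0 & forall i, (i < m)%N -> p`_i = 0.
  have ex : exists m, p`_m != 0.
    by exists (size p).-1; rewrite -/(lead_coef p) lead_coef_eq0.
  case: (ex_minnP ex) => m pm hm; exists m => // i im.
  by apply/eqP; apply: contraTT im => /hm; rewrite leqNgt.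
apply: (descent _ N) => [b|b IH]; first exact: xN.
have := h (b + m%:R); rewrite (@pact_wide _ _ (m.+1 + size p)); last first.
  by rewrite leq_addl.
rewrite big_split_ord big_ord_recr /= addrK big1 => [|i _]; last first.
  by rewrite hm ?mul0r.
rewrite [X in _ + X]big1 ?add0r ?addr0 => [/eqP|i _].
  by rewrite mulf_eq0 (negPf pm) => /eqP.
rewrite (_ : b + _ - _ = b - i.+1%:R) ?IH ?mulr0 //.
by rewrite addSnnS natrD; ring.
Qed.

(** The families which converge for [|t| < 1]: up to finitely many factors
    [large^r * t^b0] they are power series in [t], and [good_growth] says that
    the radius of convergence is at least 1, as [expR (e * Re b)] is [q ^ n]
    times a constant along [b = b0 + n], where [q := expR e] is any number
    above 1. *)
Record good c : Prop := Good {
  good_total : exists s : seq CC, forall r b, c r b <> 0 -> r \in s;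
  good_small : exists s : seq CC, forall r b, c r b <> 0 ->
    exists (b0 : CC) (n : nat), b0 \in s /\ b = b0 + n%:R;
  good_growth : forall e : R, 0 < e -> exists K : R, forall r b,
    normc (c r b) <= K * expR (e * Re b) }.

Lemma good0 : good (fun _ _ => 0).
Proof.
split; try by exists [::].
by move=> e e0; exists 0 => r b; rewrite Normc.normc0 mul0r.
Qed.

Lemma good_lin a x y : good x -> good y -> good (fun r b => a * x r b + y r b).
Proof.
move=> [[s xs] [s' xs'] xg] [[t yt] [t' yt'] yg]; split.
- exists (s ++ t) => r b; rewrite mem_cat; case: (eqVneq (x r b) 0) => [->|/eqP/xs->] //.
  by rewrite mulr0 add0r => /yt ->; rewrite orbT.
- exists (s' ++ t') => r b; case: (eqVneq (x r b) 0) => [->|/eqP/xs'].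
    rewrite mulr0 add0r => /yt' [b0 [n [h ->]]]; exists b0, n.
    by rewrite mem_cat h orbT.
  by move=> [b0 [n [h ->]]] _; exists b0, n; rewrite mem_cat h.
- move=> e e0; have [K hK] := xg _ e0; have [L hL] := yg _ e0.
  exists (normc a * K + L) => r b; apply: (le_trans (le_normcD _ _)).
  rewrite mulrDl lerD // Normc.normcM -mulrA ler_wpM2l ?normc_ge0 //.
Qed.

Lemma good_shift z w x : good x -> good (fun r b => x (r - z) (b - w)).
Proof.
move=> [[s xs] [s' xs'] xg]; split.
- exists [seq r + z | r <- s] => r b /xs h.
  by apply/mapP; exists (r - z) => //; rewrite subrK.
- exists [seq b + w | b <- s'] => r b /xs' [b0 [n [h e]]].
  exists (b0 + w), n; split; first exact: map_f.
  by rewrite addrAC -e subrK.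
- move=> e e0; have [K hK] := xg _ e0; exists (K * expR (- e * Re w)) => r b.
  apply: (le_trans (hK _ _)); rewrite -mulrA -expRD ReB.
  by rewrite (_ : e * (Re b - Re w) = - e * Re w + e * Re b) //; ring.
Qed.

Lemma good_sum I (s : seq I) (x : I -> fam) :
  (forall i, good (x i)) -> good (fun r b => \sum_(i <- s) x i r b).
Proof.
move=> h; elim: s => [|i s IH].
  rewrite (_ : (fun _ _ => _) = fun _ _ => 0); first exact: good0.
  by apply/funext => r; apply/funext => b; rewrite big_nil.
rewrite (_ : (fun _ _ => _) = fun r b => 1 * x i r b + \sum_(i <- s) x i r b).
  exact: good_lin.
by apply/funext => r; apply/funext => b; rewrite big_cons mul1r.
Qed.

Lemma good_pact p x : good x -> good (pact p x).
Proof.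
move=> gx; apply: (@good_sum _ _ (fun (i : 'I_(size p)) r b => p`_i * x r (b - i%:R))) => i.
have := @good_lin p`_i _ _ (good_shift 0 i%:R gx) good0.
congr good; apply/funext => r; apply/funext => b.
by rewrite subr0 addr0.
Qed.

(** Growth of [x] along [b, b - 1, b - 2, ...], relative to the weight
    [expR (e * Re b)]. *)
Definition grows (e : R) (r b : CC) (K : R) x : Prop :=
  forall m : nat, normc (x r (b - m%:R)) <= K * expR (e * (Re b - m%:R)).

Lemma growsD e r b K L x y : grows e r b K x -> grows e r b L y ->
  grows e r b (K + L) (fun r b => x r b + y r b).
Proof.
move=> h h' m; apply: (le_trans (le_normcD _ _)).
by rewrite mulrDl lerD.
Qed.

Lemma grows_sum e r b I (s : seq I) (K : I -> R) (x : I -> fam) :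
  (forall i, grows e r b (K i) (x i)) ->
  grows e r b (\sum_(i <- s) K i) (fun r b => \sum_(i <- s) x i r b).
Proof.
move=> h m; apply: (le_trans (ler_normc_sum _ _ _)).
rewrite mulr_suml; apply: ler_sum => i _; exact: h.
Qed.

Lemma grows_pact e r b K p x : 0 <= e -> 0 <= K -> grows e r b K x ->
  grows e r b ((\sum_(i < size p) normc p`_i) * K) (pact p x).
Proof.
move=> e0 K0 h; rewrite mulr_suml.
apply: (@grows_sum _ _ _ _ _ _ (fun (i : 'I_(size p)) r b => p`_i * x r (b - i%:R))) => i m.
rewrite Normc.normcM -mulrA ler_wpM2l ?normc_ge0 //.
have := h (m + i)%N; rewrite natrD opprD addrA => /le_trans; apply.
rewrite ler_wpM2l // ler_expR ler_wpM2l //.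
by have : (0:R) <= i%:R by []; lra.
Qed.

(** Division by [1 - s 't] multiplies the bound by the sum of a geometric
    series. *)
Lemma grows_div e s r b K x : 0 < e -> normc s <= 1 -> trunc x -> 0 <= K ->
  grows e r b K (pact (1 - s *: 'X) x) -> grows e r b (K / (1 - expR (- e))) x.
Proof.
move=> e0 s1 [N xN] K0 h.
have q1 : 0 < 1 - expR (- e) by rewrite subr_gt0 expR_lt1 oppr_lt0.
set L := K / _.
have L0 : 0 <= L by rewrite divr_ge0 // ltW.
suff H (c : CC) : (exists m : nat, c = b - m%:R) ->
    normc (x r c) <= L * expR (e * Re c).
  by move=> m; have := H _ (ex_intro _ m erefl); rewrite ReB Re_nat.
move: c; apply: (descent (fun c : CC => (exists m : nat, c = b - m%:R) ->
    normc (x r c) <= L * expR (e * Re c)) N).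
  by move=> c /xN ->; rewrite Normc.normc0 mulr_ge0 ?expR_ge0.
move=> c IH [m cm].
have -> : x r c = pact (1 - s *: 'X) x r c + s * x r (c - 1).
  by rewrite pactDl pactNl pactZl pactX pactC mul1r subrK.
apply: (le_trans (le_normcD _ _)).
have h1 := h m; rewrite -cm in h1.
have h2 : normc (x r (c - 1)) <= L * expR (e * (Re c - 1)).
  have := IH 0; rewrite ReB /=; apply; exists m.+1.
  by rewrite cm -natr1; ring.
rewrite Normc.normcM.
have -> : L * expR (e * Re c) =
    K * expR (e * (Re b - m%:R)) + 1 * (L * expR (e * (Re c - 1))).
  rewrite (_ : e * (Re c - 1) = e * Re c + - e); last by ring.
  rewrite expRD -(Re_nat _ m) -ReB -cm.
  rewrite (_ : K = L * (1 - expR (- e))); last by rewrite /L divfK ?gt_eqF.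
  by ring.
by rewrite lerD // ler_pM ?normc_ge0.
Qed.

(** The quotient by [1 - s t] has the same total exponents, because the action
    is torsion-free; the same progressions of small exponents, by descent, as
    [x r b] is [s * x r (b - 1)] wherever [(1 - s t) x] vanishes; and the same
    growth, by [grows_div]. *)
Lemma good_div s x : normc s <= 1 -> trunc x -> good (pact (1 - s *: 'X) x) ->
  good x.
Proof.
move=> s1 tx [[rs hr] [bs hb] hg].
have xE r b : x r b = pact (1 - s *: 'X) x r b + s * x r (b - 1).
  by rewrite pactDl pactNl pactZl pactX pactC mul1r subrK.
have [N xN] := tx; split.
- exists rs => r b; apply: contra_notT => h.
  apply: (pact_inj tx (p := 1 - s *: 'X)) => [|c].
    apply/eqP => /(congr1 (fun p : {poly CC} => p`_0)).
    by rewrite coefB coef1 coefZ coefX mulr0 subr0 coef0 => /eqP; rewrite oner_eq0.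
  by apply: contrapT => /hr; rewrite (negPf h).
- exists bs => r b.
  move: b; apply: (descent (fun b => x r b <> 0 -> exists (b0 : CC) (n : nat),
    b0 \in bs /\ b = b0 + n%:R) N) => [b /xN //|b IH].
  case: (eqVneq (pact (1 - s *: 'X) x r b) 0) => [e0|/eqP/hb//].
  rewrite xE e0 add0r => h.
  have [] := IH 0; first by move=> e; apply: h; rewrite e mulr0.
  move=> b0 [n [hb0 e]]; exists b0, n.+1; split => //.
  by rewrite -natr1 addrA -e subrK.
- move=> e e0; have [K hK] := hg _ e0.
  exists (Num.max 0 K / (1 - expR (- e))) => r b.
  have := @grows_div e s r b (Num.max 0 K) x e0 s1 tx.
  rewrite le_max lexx => /(_ isT) h; have := h _ 0; rewrite !subr0; apply => m.
  apply: (le_trans (hK _ _)); rewrite ReB Re_nat ler_wpM2r ?expR_ge0 //.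
  by rewrite le_max lexx orbT.
Qed.

Lemma good_divn s k x : normc s <= 1 -> trunc x ->
  good (pact ((1 - s *: 'X) ^+ k) x) -> good x.
Proof.
move=> s1; elim: k x => [|k IH] x tx.
  by congr good; apply/funext => r; apply/funext => b; rewrite pactC mul1r.
rewrite exprSr => h; apply: (good_div s1) => //; apply: IH.
  exact: trunc_pact.
by move: h; congr good; apply/funext => r; apply/funext => b; rewrite pactM.
Qed.

Lemma grows_divn e s k r b K x : 0 < e -> normc s <= 1 -> trunc x -> 0 <= K ->
  grows e r b K (pact ((1 - s *: 'X) ^+ k) x) ->
  grows e r b (K * (1 - expR (- e))^-1 ^+ k) x.
Proof.
move=> e0 s1; elim: k x => [|k IH] x tx K0.
  by rewrite mulr1 => h m; have := h m; rewrite pactC mul1r.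
have q1 : 0 < 1 - expR (- e) by rewrite subr_gt0 expR_lt1 oppr_lt0.
rewrite [in X in X -> _]exprSr exprSr mulrA => h; apply: (@grows_div _ s) => //.
  by rewrite mulr_ge0 ?exprn_ge0 ?invr_ge0 // ltW.
by apply: IH => // [|m]; [exact: trunc_pact | rewrite -pactM; exact: h].
Qed.

End Families.

Lemma fsum_nat (U : zmodType) (f : nat -> U) n :
  (forall j, (n <= j)%N -> f j = 0) ->
  \sum_(j \in [set: nat]) f j = \sum_(j < n) f j.
Proof.
move=> h; rewrite fsbig_ord; apply/esym/fsbig_widen => // j [_ /= /negP].
by rewrite -leqNgt => /h.
Qed.

(** * Regular singular systems *)

Section RegularSpan.
Variable R : realType.
Local Notation CC := (R[i]).
Local Notation normc := (@Normc.normc R).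
Local Notation Re := (@complex.Re R).
Local Notation fam := (CC -> CC -> CC).
Implicit Types (x y g : fam) (r b : CC) (p q : {poly CC}).

Lemma trunc_nat x r b : trunc x ->
  exists n : nat, forall m, (n <= m)%N -> x r (b - m%:R) = 0.
Proof.
move=> [N h]; exists (Num.Def.truncn `|Re b - N|).+1 => m hm.
apply: h; rewrite ReB Re_nat.
have := truncnS_gt `|Re b - N|; have := ler_norm (Re b - N).
by move: hm; rewrite -(ler_nat R); lra.
Qed.

(** Multiplication by the binomial series of [(1 - s t)^-(i+1)]. *)
Definition invpow (s : CC) (i : nat) x : fam := fun r b =>
  \sum_(l \in [set: nat]) ('C(l + i, i)%:R * s ^+ l) * x r (b - l%:R).

Lemma invpow_finite s i x r b n :
  (forall m, (n <= m)%N -> x r (b - m%:R) = 0) ->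
  invpow s i x r b =
  \sum_(l < n) ('C(l + i, i)%:R * s ^+ l) * x r (b - l%:R).
Proof. by move=> h; apply: fsum_nat => j /h ->; rewrite mulr0. Qed.

(** By Pascal's rule, each factor [1 - s t] lowers the index of the binomial
    series by one. *)
Lemma pact_invpow s i x : trunc x ->
  pact ((1 - s *: 'X) ^+ i.+1) (invpow s i x) = x.
Proof.
move=> tx.
have step j r b : pact (1 - s *: 'X) (invpow s j x) r b =
    if j is j'.+1 then invpow s j' x r b else x r b.
  rewrite pactDl pactNl pactZl pactX pactC mul1r.
  have [n hn] := trunc_nat r b tx.
  have hn1 m : (n <= m)%N -> x r (b - 1 - m%:R) = 0.
    by move=> h; rewrite -addrA -opprD nat1r hn // leqW.
  have hn' m : (n.+1 <= m)%N -> x r (b - m%:R) = 0 by move=> h; rewrite hn 1?ltnW.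
  rewrite (invpow_finite _ _ hn1) (invpow_finite _ _ hn') big_ord_recl.
  rewrite add0n binn mul1r expr0 mul1r subr0 mulr_sumr -addrA -sumrB.
  case: j => [|j].
    rewrite big1 ?addr0 // => l _.
    rewrite /= /bump /= add1n !addn0 !bin0 -addrA -opprD nat1r exprS.
    by ring.
  rewrite (invpow_finite _ _ hn') big_ord_recl.
  rewrite add0n binn mul1r expr0 mul1r subr0; congr (_ + _).
  apply: eq_bigr => l _.
  rewrite /= /bump /= add1n -addrA -opprD nat1r exprS !addSn !addnS binS natrD.
  by ring.
elim: i => [|i IH]; apply/funext => r; apply/funext => b.
  by rewrite expr1 step.
rewrite exprSr pactM -{2}IH; apply: eq_pact => c; exact: step.
Qed.

Section Span.
Variables (s : CC) (n : nat) (e : 'I_n -> fam).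

(** The span of the [e i] over the ring [C[t, (1 - s t)^-1]], modulo the good
    families.  The denominator is cleared, so that only polynomials act and
    determinants of matrices of polynomials are available. *)
Definition regspan x : Prop := exists k (p : 'I_n -> {poly CC}) g, good g /\
  forall r b, pact ((1 - s *: 'X) ^+ k) x r b =
    \sum_i pact (p i) (e i) r b + g r b.

Lemma regspan_good g : good g -> regspan g.
Proof.
move=> h; exists 0, (fun _ => 0), g; split => // r b.
by rewrite pactC mul1r big1 ?add0r // => i _; rewrite pact0.
Qed.

Lemma regspan_gen i : regspan (e i).
Proof.
exists 0, (fun j => (j == i)%:R%:P), (fun _ _ => 0); split; first exact: good0.
move=> r b; rewrite addr0 pactC mul1r (bigD1 i) //= eqxx pactC mul1r.
by rewrite big1 ?addr0 // => j /negPf ->; rewrite pactC mul0r.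
Qed.

Lemma regspan_raise k x q (p : 'I_n -> {poly CC}) g : good g ->
  (forall r b, pact q x r b = \sum_i pact (p i) (e i) r b + g r b) ->
  let d := (1 - s *: 'X) ^+ k in
  good (pact d g) /\
  forall r b, pact (d * q) x r b =
    \sum_i pact (d * p i) (e i) r b + pact d g r b.
Proof.
move=> gg h d; split; first exact: good_pact.
move=> r b; rewrite pactM (eq_pactf _ h) pactDr pact_sumr.
by congr (_ + _); apply: eq_bigr => i _; rewrite pactM.
Qed.

Lemma regspan_lin a x y : regspan x -> regspan y ->
  regspan (fun r b => a * x r b + y r b).
Proof.
move=> [k [p [g [gg hx]]]] [l [q [f [gf hy]]]].
have [gg' hx'] := regspan_raise l gg hx; have [gf' hy'] := regspan_raise k gf hy.
exists (l + k)%N, (fun i => a *: ((1 - s *: 'X) ^+ l * p i) + (1 - s *: 'X) ^+ k * q i).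
eexists; split; first exact: (good_lin a gg' gf').
move=> r b; rewrite pactDr (pactZr _ (fun _ => a)) exprD hx' (mulrC (_ ^+ l)) hy'.
under [in RHS]eq_bigr do rewrite pactDl pactZl.
by rewrite big_split /= -mulr_sumr; ring.
Qed.

Lemma regspan_pact q x : regspan x -> regspan (pact q x).
Proof.
move=> [k [p [g [gg hx]]]]; exists k, (fun i => q * p i), (pact q g); split.
  exact: good_pact.
move=> r b; rewrite -pactM mulrC pactM (eq_pactf _ hx) pactDr pact_sumr.
by congr (_ + _); apply: eq_bigr => i _; rewrite pactM.
Qed.

Lemma regspan_invpow i x : trunc x -> regspan x -> regspan (invpow s i x).
Proof.
move=> tx [k [p [g [gg hx]]]]; exists (k + i.+1)%N, p, g; split => // r b.
by rewrite exprD pactM pact_invpow.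
Qed.

Lemma regspan_common (x : 'I_n -> fam) : (forall i, regspan (x i)) ->
  exists k (p : 'I_n -> 'I_n -> {poly CC}) (g : 'I_n -> fam),
  (forall i, good (g i)) /\ forall i r b, pact ((1 - s *: 'X) ^+ k) (x i) r b =
    \sum_j pact (p i j) (e j) r b + g i r b.
Proof.
move=> /fin_all_exists [k /fin_all_exists [p /fin_all_exists [g h]]].
pose m := (\max_i k i)%N; pose d i := (1 - s *: 'X) ^+ (m - k i).
exists m, (fun i j => d i * p i j), (fun i => pact (d i) (g i)); split => i.
  by have [] := h i => gg _; exact: good_pact.
have [gg hi] := h i; have [_ H] := regspan_raise (m - k i) gg hi.
by move=> r b; rewrite -H -exprD subnK // leq_bigmax.
Qed.

(* The last condition makes [t = 2] a point where no [t * (1 - s t)^k]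
   vanishes; [s] is 1 or -1 in the applications. *)
Hypotheses (s1 : normc s <= 1) (s2 : 1 - s * 2 != 0).
Hypothesis e_trunc : forall i, trunc (e i).
Hypothesis e_total : forall i, regspan (fun r b => r * e i r (b - 1)).
Hypothesis e_small : forall i, regspan (fun r b => b * e i r b).

Lemma seq_roots p : p != 0 -> exists u : seq CC, forall z, root p z -> z \in u.
Proof.
move=> p0; have [u hu] := closed_field_poly_normal p; exists u => z.
by rewrite hu rootZ ?lead_coef_eq0 // root_prod_XsubC.
Qed.

Lemma trunc_uniform : exists N : R, forall j r b, Re b < N -> e j r b = 0.
Proof.
have /fin_all_exists [N hN] := e_trunc.
exists (- \sum_j `|N j|) => j r b hb; apply: (hN j).
apply: (lt_le_trans hb); rewrite (bigD1 j) //=.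
have := ler_norm (- N j); rewrite normrN.
have : 0 <= \sum_(i0 < n | i0 != j) `|N i0| by apply: sumr_ge0.
by lra.
Qed.

Lemma merge_supports (I : finType) (P : I -> CC -> Prop) :
  (forall i, exists u : seq CC, forall z, P i z -> z \in u) ->
  exists u : seq CC, forall i z, P i z -> z \in u.
Proof.
move=> /fin_all_exists [u hu]; exists (flatten [seq u i | i : I]) => i z /hu hz.
by apply/flattenP; exists (u i) => //; apply/mapP; exists i; rewrite ?mem_enum.
Qed.

(** For a fixed total exponent [r], the relations [e_total] form a linear system
    [M r] over [C[t]] for the vector [(e j r)_j], whose right hand side is zero
    for all but finitely many [r].  If [\det (M r)] is not the zero polynomial,
    Cramer's rule and torsion-freeness give [e j r = 0].  The value of
    [\det (M r)] at [t = 2] is, up to a nonzero factor, a characteristic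
    polynomial evaluated at [r], so that finitely many [r] remain. *)
Lemma frobenius_total i : exists u : seq CC,
  forall r b, e i r b <> 0 -> r \in u.
Proof.
have [k [p [g [gg h]]]] := regspan_common e_total.
have [ug hug] : exists u : seq CC, forall i r b, g i r b <> 0 -> r \in u.
  have [|u hu] := @merge_supports _ (fun i r => exists b, g i r b <> 0).
    by move=> j; have [[u hu] _ _] := gg j; exists u => z [b /hu].
  by exists u => j r b hb; apply: (hu j); exists b.
pose d : {poly CC} := (1 - s *: 'X) ^+ k.
pose D : 'M[{poly CC}]_n := \matrix_(i, j) p i j.
pose M r : 'M[{poly CC}]_n := (r *: ('X * d))%:M - D.
have eqM r j b : \sum_l pact (M r j l) (e l) r b = g j r b.
  have -> : g j r b = pact (r *: ('X * d)) (e j) r b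
      - \sum_l pact (D j l) (e l) r b.
    under [in RHS]eq_bigr do rewrite mxE.
    rewrite (mulrC 'X) pactZl pactM.
    have -> : r * pact d (pact 'X (e j)) r b =
        pact d (fun r b => r * pact 'X (e j) r b) r b.
      exact/esym/(pactZr d (fun z => z)).
    apply: (canRL (addrK _)).
    by rewrite addrC -h; apply: eq_pact => c; rewrite pactX.
  have -> : pact (r *: ('X * d)) (e j) r b =
      \sum_l pact ((r *: ('X * d))%:M j l) (e l) r b.
    rewrite (bigD1 j) //= mxE eqxx mulr1n big1 ?addr0 // => l /negPf hl.
    by rewrite mxE eq_sym hl mulr0n pact0.
  by rewrite -sumrB; apply: eq_bigr => l _; rewrite -pactNl -pactDl !mxE.
pose ev (B : 'M[{poly CC}]_n) : 'M[CC]_n := map_mx (horner_eval (2 : CC)) B.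
have d2 : ('X * d).[2] != 0.
  by rewrite hornerM hornerX horner_exp !hornerE mulf_neq0 ?expf_neq0 // pnatr_eq0.
pose A : 'M[CC]_n := ('X * d).[2]^-1 *: ev D.
have [ur hur] := seq_roots (monic_neq0 (char_poly_monic A)).
exists (ur ++ ug) => r b; apply: contra_notT.
rewrite mem_cat negb_or => /andP[rA rg].
have g0 j c : g j r c = 0 by apply: contrapT => /hug; rewrite (negPf rg).
have det0 : \det (M r) != 0.
  apply: contraNneq (rA) => det0; apply: hur; rewrite -eigenvalue_root_char.
  rewrite /eigenvalue /eigenspace kermx_eq0 row_free_unit unitmxE unitfE negbK.
  have -> : A - r%:M = - ('X * d).[2]^-1 *: ev (M r).
    apply/matrixP => a c; rewrite !mxE /horner_eval hornerD hornerN hornerMn hornerZ.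
    by case: (a == c); rewrite ?mulr1n ?mulr0n; field; exact: d2.
  by rewrite detZ (det_map_mx (horner_eval (2 : CC))) det0 /= /horner_eval horner0 mulr0.
apply: (pact_inj (e_trunc i) det0) => c.
have -> : pact (\det (M r)) (e i) r c =
    \sum_l pact ((\adj (M r) *m M r) i l) (e l) r c.
  rewrite mul_adj_mx (bigD1 i) //= mxE eqxx mulr1n big1 ?addr0 // => l /negPf hl.
  by rewrite mxE eq_sym hl mulr0n pact0.
under eq_bigr do rewrite mxE pact_suml.
rewrite exchange_big /= big1 // => j _.
under eq_bigr do rewrite pactM.
rewrite -(@pact_sumr _ _ _ _ (fun l => pact (M r j l) (e l))).
rewrite /pact big1 // => l _.
by rewrite eqM g0 mulr0.
Qed.

(** The smallest exponents are the indicial roots: if [e j r (b - m)] vanishes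
    for all [m > 0], the relations [e_small] at [b] only see the constant terms
    of the polynomials, and make [(e j r b)_j] an eigenvector with eigenvalue
    [b], unless the right hand side contributes at [b]. *)
Lemma frobenius_small i : exists u : seq CC, forall r b, e i r b <> 0 ->
  exists (b0 : CC) (m : nat), b0 \in u /\ b = b0 + m%:R.
Proof.
have [k [p [g [gg h]]]] := regspan_common e_small.
have /fin_all_exists [ug hug] j : exists u : seq CC, forall r b, g j r b <> 0 ->
    exists (b0 : CC) (m : nat), b0 \in u /\ b = b0 + m%:R.
  by have [] := gg j.
pose A : 'M[CC]_n := (\matrix_(i, j) (p i j)`_0)^T.
have [ur hur] := seq_roots (monic_neq0 (char_poly_monic A)).
pose u := ur ++ flatten [seq ug i | i : 'I_n].
exists u => r b.
suff H : (forall (b0 : CC) (m : nat), b0 \in u -> b <> b0 + m%:R) ->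
    forall j, e j r b = 0.
  move=> hb; apply: contrapT => nex; apply: hb; apply: H => b0 m hb0 bE.
  by apply: nex; exists b0, m.
have [N eN] := trunc_uniform.
move: b; apply: (descent (fun b => (forall (b0 : CC) (m : nat), b0 \in u ->
  b <> b0 + m%:R) -> forall j, e j r b = 0) N) => [b hb _ j|b IH hb]; first exact: eN.
have e0 j (m : nat) : e j r (b - m.+1%:R) = 0.
  apply: (IH m) => b0 l hb0 bE; apply: (hb b0 (l + m.+1)%N hb0).
  by rewrite natrD addrA -bE subrK.
have g0 j : g j r b = 0.
  apply: contrapT => /hug [b0 [m [hb0 bE]]]; apply: (hb b0 m _ bE).
  rewrite mem_cat; apply/orP; right; apply/flattenP; exists (ug j) => //.
  by apply/mapP; exists j; rewrite ?mem_enum.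
pose v : 'rV[CC]_n := \row_j e j r b.
have vA : v *m A = b *: v.
  apply/rowP => j; rewrite !mxE.
  have := h j r b; rewrite pact_first => [|m]; last by rewrite e0 mulr0.
  have -> : ((1 - s *: 'X) ^+ k)`_0 = 1.
    by rewrite -horner_coef0 horner_exp hornerD hornerN hornerZ hornerX hornerC
      mulr0 subr0 expr1n.
  rewrite mul1r => ->.
  rewrite g0 addr0; apply: eq_bigr => l _; rewrite !mxE pact_first => [|m //].
  by rewrite mulrC.
have [v0|v0] := eqVneq v 0; first by move=> j; have /rowP/(_ j) := v0; rewrite !mxE.
have bu : b \in u.
  by rewrite mem_cat hur // -eigenvalue_root_char; apply/eigenvalueP; exists v.
by have := hb b 0%N bu; rewrite addr0.
Qed.

Lemma exists_max_ord (f : 'I_n -> R) (i : 'I_n) :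
  exists j, forall l, f l <= f j.
Proof.
case: (@Order.TotalTheory.arg_maxP _ _ _ i xpredT f) => // j _ hj.
by exists j => l; exact: hj.
Qed.

(** Let [w j] be [normc (e j r b)] divided by [expR (a * Re b)].  If [w j] is
    maximal among the [w l] and exceeds the bound [K] valid at the earlier
    exponents, the relations [e_small] give [normc b * w j <= C * w j] for a
    constant [C] depending on [a] alone, hence [Re b <= C]; and only finitely
    many exponents of the support lie there. *)
Lemma frobenius_growth i (a : R) : 0 < a ->
  exists K : R, forall r b, normc (e i r b) <= K * expR (a * Re b).
Proof.
move=> a0; have [k [p [g [gg h]]]] := regspan_common e_small.
have /fin_all_exists [Kg hKg] j : exists K : R, forall r b,
    normc (g j r b) <= K * expR (a * Re b).
  by have [_ _ /(_ a a0)] := gg j.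
(* a common bound for the inhomogeneous terms *)
have [K0 K00 hK0] := exists_bound_seq (enum 'I_n) Kg.
have hg j r b : normc (g j r b) <= K0 * expR (a * Re b).
  by apply: (le_trans (hKg _ _ _)); rewrite ler_wpM2r ?expR_ge0 ?hK0 ?mem_enum.
pose S i j : R := \sum_(l < size (p i j)) normc (p i j)`_l.
have S0 l j : 0 <= S l j by apply: sumr_ge0 => *; exact: normc_ge0.
pose D : R := (1 - expR (- a))^-1 ^+ k.
have D0 : 0 <= D.
  by rewrite exprn_ge0 // invr_ge0 ltW // subr_gt0 expR_lt1 oppr_lt0.
have [C C0 hC] := exists_bound_seq (enum 'I_n) (fun i => ((\sum_j S i j) + 1) * D).
have main r b K : K0 <= K -> (forall j, grows a r b K (e j)) ->
    forall j, normc b * normc (e j r b) <= C * K * expR (a * Re b).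
  move=> K0K hK j; have K_ge0 := le_trans K00 K0K.
  have tb : trunc (fun r b => b * e j r b).
    by have [N hN] := e_trunc j; exists N => r' b' /hN ->; rewrite mulr0.
  have gr : grows a r b (\sum_j0 S j j0 * K + K) 
      (pact ((1 - s *: 'X) ^+ k) (fun r b => b * e j r b)).
    have g1 : grows a r b (\sum_j0 S j j0 * K)
        (fun r b => \sum_j0 pact (p j j0) (e j0) r b).
      apply: (@grows_sum _ _ _ _ _ _ _ (fun j0 => pact (p j j0) (e j0))) => l.
      by apply: grows_pact => //; exact: ltW.
    have g2 : grows a r b K (g j).
      move=> m; apply: (le_trans (hg _ _ _)).
      by rewrite ReB Re_nat ler_wpM2r ?expR_ge0.
    by move=> m; rewrite h; exact: (growsD g1 g2 m).
  have := grows_divn a0 s1 tb _ gr => /(_ _ 0); rewrite !subr0 Normc.normcM.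
  move=> /(_ _)/le_trans; apply.
    by rewrite addr_ge0 ?sumr_ge0 // => l _; rewrite mulr_ge0.
  rewrite ler_wpM2r ?expR_ge0 // -mulr_suml -[X in _ + X]mul1r -mulrDl mulrAC.
  by rewrite ler_wpM2r // hC ?mem_enum.
have /fin_all_exists [us hus] := frobenius_small.
have /fin_all_exists [ur hur] := frobenius_total.
(* the finitely many exponents with small real part *)
have /fin_all_exists [K1 hK1] j : exists K : R, forall r b, Re b <= C ->
    normc (e j r b) <= K * expR (a * Re b).
  have [B _ hB] := exists_bound_seq (us j) (fun b0 => C - Re b0).
  pose T := [seq (r, b) | r <- ur j,
    b <- [seq b0 + m%:R | b0 <- us j, m <- iota 0 (Num.Def.truncn B).+1]].
  have [K K_ge0 hK] := exists_bound_seq T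
    (fun rb => normc (e j rb.1 rb.2) / expR (a * Re rb.2)).
  exists K => r b hb; have [->|/eqP ejn] := eqVneq (e j r b) 0.
    by rewrite Normc.normc0 mulr_ge0 ?expR_ge0.
  rewrite -ler_pdivrMr ?expR_gt0 //; apply: (hK (r, b)).
  have [b0 [m [hb0 bE]]] := hus _ _ _ ejn.
  apply/allpairsP; exists (r, b); split => //; first exact: (hur _ _ _ ejn).
  apply/allpairsP; exists (b0, m); split => //.
  rewrite mem_iota /= add0n ltnS.
  have mB : m%:R <= B.
    by apply: le_trans (hB _ hb0); move: hb; rewrite bE ReD Re_nat; lra.
  by rewrite truncn_ge_nat // (le_trans _ mB).
have [K2 _ hK2] := exists_bound_seq (enum 'I_n) K1.
pose K := Num.max K0 K2; exists K => r b; move: i.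
have [N eN] := trunc_uniform.
have K_ge0 : 0 <= K by rewrite le_max K00.
move: b; apply: (descent (fun b => forall j,
  normc (e j r b) <= K * expR (a * Re b)) N) => [b hb j|b IH l].
  by rewrite eN // Normc.normc0 mulr_ge0 ?expR_ge0.
pose f j := normc (e j r b) / expR (a * Re b).
have [j hj] := exists_max_ord f l.
rewrite -ler_pdivrMr ?expR_gt0 // -/(f l); apply: (le_trans (hj l)).
have [//|Kf] := leP (f j) K.
have fE j' : normc (e j' r b) = f j' * expR (a * Re b).
  by rewrite /f divfK // gt_eqF ?expR_gt0.
have gr j' : grows a r b (f j) (e j').
  case=> [|m]; first by rewrite !subr0 fE ler_wpM2r ?expR_ge0.
  apply: (le_trans (IH m j')); rewrite ReB Re_nat ler_wpM2r ?expR_ge0 //.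
  exact: ltW.
have K0f : K0 <= f j by apply: le_trans (ltW Kf); rewrite le_max lexx.
have := main r b (f j) K0f gr j.
rewrite fE mulrA ler_pM2r ?expR_gt0 // ler_pM2r ?(le_lt_trans K_ge0) // => bC.
have := hK1 j r b (le_trans (ler_Re_normc b) bC).
rewrite fE ler_pM2r ?expR_gt0 // => h1; suff : f j <= K by rewrite leNgt Kf.
apply: (le_trans h1).
by rewrite le_max hK2 ?orbT ?mem_enum.
Qed.

(** Frobenius' theorem: solutions of a regular singular system converge as far
    as its coefficients do. *)
Theorem frobenius i : good (e i).
Proof.
split; [exact: frobenius_total | exact: frobenius_small | exact: frobenius_growth].
Qed.

Lemma regspan_is_good x : trunc x -> regspan x -> good x.
Proof.
move=> tx [k [p [g [gg h]]]]; apply: (good_divn (k := k) s1 tx).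
rewrite (_ : pact _ x = fun r b => 1 * (\sum_i pact (p i) (e i) r b) + g r b).
  by apply: good_lin => //; apply: good_sum => j; apply: good_pact; exact: frobenius.
by apply/funext => r; apply/funext => b; rewrite h mul1r.
Qed.

End Span.
End RegularSpan.

(** * Graded modules and their generators *)

HB.instance Definition _ (R : realType) (V : voa R) (W : vmodule V) (a : V)
    (n : int) :=
  GRing.isLinear.Build R[i] W W _ (mmode a n) (mmode_linearr a n).

HB.instance Definition _ (R : realType) (V : voa R) (A B D : vmodule V)
    (Y : log_intertwiner A B D) h v s :=
  GRing.isLinear.Build R[i] B D _ (Y h v s) (lio_linearr Y h v s).

Section Grading.
Variables (K : fieldType) (W : lmodType K) (g : nat -> set W).
Hypothesis dg : direct_sum g.

Lemma homog0 d : g d 0. Proof. by have [/(_ d) []] := dg. Qed.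

Lemma homog_lin d a x y : g d x -> g d y -> g d (a *: x + y).
Proof. by have [/(_ d) [_ h] _ _] := dg; apply: h. Qed.

Lemma homog_scale d a x : g d x -> g d (a *: x).
Proof. by move=> gx; rewrite -[_ *: _]addr0; apply/homog_lin/homog0. Qed.

Lemma homog_sum d I (s : seq I) (Q : pred I) (x : I -> W) :
  (forall i, Q i -> g d (x i)) -> g d (\sum_(i <- s | Q i) x i).
Proof.
move=> h; apply: big_ind => //; first exact: homog0.
by move=> u v gu gv; rewrite -[u]scale1r; apply: homog_lin.
Qed.

Lemma homog_component m w (L : seq (nat * W)) :
  (forall p, p \in L -> g p.1 p.2) -> g m w -> w = \sum_(p <- L) p.2 ->
  w = \sum_(p <- L | p.1 == m) p.2.
Proof.
move=> hL gw wE; have [_ _ uniq0] := dg.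
pose f d := \sum_(p <- L | p.1 == d) p.2 - (if d == m then w else 0).
pose s := undup (m :: map fst L).
have us : uniq s by exact: undup_uniq.
have hf d : g d (f d).
  rewrite /f addrC -scaleN1r; apply: homog_lin.
    by case: eqP => [->|_] //; exact: homog0.
  rewrite big_seq_cond; apply: homog_sum => p /andP[/hL gp /eqP <-] //.
have s0 : \sum_(d <- s) f d = 0.
  have delta (d' : nat) (x : W) : d' \in s -> \sum_(d <- s) (if d == d' then x else 0) = x.
    move=> hd; rewrite (bigD1_seq d' hd us) /= eqxx big1 ?addr0 // => d /negPf -> //.
  rewrite sumrB (exchange_big_dep xpredT) //= delta ?mem_undup ?mem_head //.
  apply/eqP; rewrite subr_eq0; apply/eqP; rewrite [RHS]wE.
  rewrite big_seq [RHS]big_seq; apply: eq_bigr => p pL.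
  under eq_bigl do rewrite eq_sym.
  by rewrite big_mkcond /= delta // mem_undup inE map_f ?orbT.
have := uniq0 _ _ us hf s0 m; rewrite mem_undup mem_head => /(_ isT).
by rewrite /f eqxx => /eqP; rewrite subr_eq0 => /eqP.
Qed.

(** Finite sums of vectors [y] with [P d y], each tagged with its degree [d]. *)
Definition pieces (P : nat -> W -> Prop) (w : W) : Prop :=
  exists2 L : seq (nat * W), forall p, p \in L -> P p.1 p.2 &
    w = \sum_(p <- L) p.2.

Lemma piecesD P u v : pieces P u -> pieces P v -> pieces P (u + v).
Proof.
move=> [L hL ->] [L' hL' ->]; exists (L ++ L') => [p|]; last by rewrite big_cat.
by rewrite mem_cat => /orP[/hL|/hL'].
Qed.

Lemma pieces_sum P I (s : seq I) (x : I -> W) :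
  (forall i, pieces P (x i)) -> pieces P (\sum_(i <- s) x i).
Proof.
move=> h; apply: big_ind => // [|u v]; last exact: piecesD.
by exists [::] => //; rewrite big_nil.
Qed.

Lemma pieces_homog w : pieces (fun d x => g d x) w.
Proof.
have [_ /(_ w) [s [f [_ gf ->]]] _] := dg.
exists [seq (d, f d) | d <- s]; last by rewrite big_map.
by move=> p /mapP[d _ ->] /=; exact: gf.
Qed.

Lemma pieces_seq (s : seq W) : exists2 L : seq (nat * W),
  forall p, p \in L -> g p.1 p.2 &
  forall x, x \in s -> pieces (fun d y => (d, y) \in L) x.
Proof.
elim: s => [|x s [L hL IH]]; first by exists [::].
have [L' hL' xE] := pieces_homog x; exists (L' ++ L) => [p|y].
  by rewrite mem_cat => /orP[/hL'|/hL].
rewrite inE => /orP[/eqP ->|/IH [M hM yE]].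
  by exists L' => // p; rewrite mem_cat -surjective_pairing => ->.
by exists M => // p /hM; rewrite mem_cat => ->; rewrite orbT.
Qed.

Lemma pieces_ind (P : nat -> W -> Prop) (Q : W -> Prop) m w :
  Q 0 -> (forall x y, Q x -> Q y -> Q (x + y)) ->
  (forall d x, P d x -> g d x) -> (forall x, P m x -> Q x) ->
  pieces P w -> g m w -> Q w.
Proof.
move=> Q0 QD Pg PQ [L hL wE] gw.
rewrite (homog_component (m := m) _ gw wE) => [|p /hL /Pg //].
rewrite big_seq_cond; apply: big_ind => // p /andP[/hL Pp /eqP pm].
by apply: PQ; rewrite -pm.
Qed.

End Grading.

Section Generators.
Variables (R : realType) (V : voa R) (W : vmodule V) (g : nat -> set W).
Hypothesis gg : is_grading g.

Lemma homog_mode d (a : V) k m w : vgr d a -> g m w ->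
  forall l : nat, m%:Z + d - k - 1 = l -> g l (mmode a k w).
Proof. by move=> ha gw l lE; have [_ /(_ _ _ k _ _ ha gw)] := gg; rewrite lE. Qed.

Lemma homog_mode0 d (a : V) k m w : vgr d a -> g m w ->
  m%:Z + d - k - 1 < 0 -> mmode a k w = 0.
Proof.
move=> ha gw; have [_ /(_ _ _ k _ _ ha gw)] := gg.
by case: (_ - 1) => // l.
Qed.

(** An induction principle for homogeneous vectors.  The list [L] collects the
    homogeneous components of finitely many vectors spanning [W] modulo
    [C1 W].  As [a_{-1} x] has positive degree relative to [x], comparing
    components of degree [m] keeps [x] of degree below [m]. *)
Lemma C1_generators : C1_cofinite W -> exists2 L : seq (nat * W),
  forall p, p \in L -> g p.1 p.2 &
  forall m (Q : W -> Prop), Q 0 ->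
    (forall a x y, Q x -> Q y -> Q (a *: x + y)) ->
    (forall x, (m, x) \in L -> Q x) ->
    (forall (d : nat) (a : V) x, (0 < d <= m)%N -> vgr d%:Z a ->
       g (m - d)%N x -> Q (mmode a (-1) x)) ->
    forall w, g m w -> Q w.
Proof.
have [dg _] := gg.
move=> [s hs]; have [L gL hL] := pieces_seq dg s; exists L => // m Q Q0 Qlin QL QC w gw.
have QD x y : Q x -> Q y -> Q (x + y) by rewrite -[x in x + y]scale1r; exact: Qlin.
have QZ a x : Q x -> Q (a *: x) by rewrite -[_ *: _]addr0 => h; exact: Qlin.
pose P d y := (exists a x, (d, x) \in L /\ y = a *: x) \/
  (exists (c : R[i]) (n : nat) (a : V) x, [/\ (0 < n <= d)%N, vgr n%:Z a,
     g (d - n)%N x & y = c *: mmode a (-1) x]).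
apply: (pieces_ind dg (P := P) Q0 QD _ _ _ gw).
- move=> d y [[a [x [xL ->]]]|[c [n [a [x [hn ha gx ->]]]]]].
    by apply: homog_scale => //; exact: (gL _ xL).
  apply: homog_scale => //; apply: (homog_mode ha gx).
  by case/andP: hn => _ hn; rewrite -subzn //; ring.
- move=> y [[a [x [xL ->]]]|[c [n [a [x [hn ha gx ->]]]]]]; apply: QZ.
    exact: QL.
  exact: QC hn ha gx.
have [x [n [a [f [fs xE]]]] [n' [a' [f' [fs' yE]]]]] := hs w.
rewrite -[w](subrK x) addrC; apply: piecesD.
  rewrite xE; apply: pieces_sum => j.
  have [M hM ->] := hL _ (fs j).
  exists [seq (p.1, a j *: p.2) | p <- M]; last by rewrite big_map scaler_sumr.
  move=> _ /mapP[p /hM pM ->]; left; exists (a j), p.2; split => //.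
rewrite yE; apply: pieces_sum => j.
have [d [b [y [d1 hb ->]]]] := fs' j.
case: d d1 hb => // d d1 hb.
have [M hM ->] := pieces_homog dg y.
exists [seq ((p.1 + d)%N, a' j *: mmode b (-1) p.2) | p <- M]; last first.
  by rewrite big_map raddf_sum scaler_sumr.
move=> _ /mapP[p /hM pM ->]; right; exists (a' j), d, b, p.2; split => //=.
  by rewrite leq_addl andbT -ltz_nat.
by rewrite addnK.
Qed.

End Generators.

(** * Reduction of correlators to generators *)

Section Reduction.
Variables (R : realType) (V : voa R).
Local Notation CC := (R[i]).
Local Notation fam := (CC -> CC -> CC).

(** The closure properties of the spans over [C[t, (1 - s t)^-1]] modulo good
    families, which are all that the reduction relations use. *)
Record reg_closed (s : CC) (P : fam -> Prop) : Prop := RegClosed {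
  rc_good : forall x, good x -> P x;
  rc_lin : forall a x y, P x -> P y -> P (fun r b => a * x r b + y r b);
  rc_shift : forall x, P x -> P (fun r b => x r (b - 1));
  rc_invpow : forall i x, trunc x -> P x -> P (invpow s i x) }.

Lemma regspan_closed s n (e : 'I_n -> fam) : reg_closed s (regspan s e).
Proof.
split; [exact: regspan_good | exact: regspan_lin | | exact: regspan_invpow].
move=> x hx; rewrite (_ : (fun _ _ => _) = pact 'X x); first exact: regspan_pact.
by apply/funext => r; apply/funext => b; rewrite pactX.
Qed.

Section ClosedTheory.
Variables (s : CC) (P : fam -> Prop).
Hypothesis hP : reg_closed s P.

Lemma rc0 : P (fun _ _ => 0). Proof. exact: rc_good hP _ (@good0 _). Qed.

Lemma rcZ a x : P x -> P (fun r b => a * x r b).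
Proof.
move=> hx; have := rc_lin hP a hx rc0.
by congr P; apply/funext => r; apply/funext => b; rewrite addr0.
Qed.

Lemma rcD x y : P x -> P y -> P (fun r b => x r b + y r b).
Proof.
move=> hx hy; have := rc_lin hP 1 hx hy.
by congr P; apply/funext => r; apply/funext => b; rewrite mul1r.
Qed.

Lemma rcB x y : P x -> P y -> P (fun r b => x r b - y r b).
Proof.
move=> hx hy; have := rc_lin hP (-1) hy hx.
by congr P; apply/funext => r; apply/funext => b; rewrite mulN1r addrC.
Qed.

Lemma rc_sum n (x : 'I_n -> fam) :
  (forall i, P (x i)) -> P (fun r b => \sum_(i < n) x i r b).
Proof.
elim: n x => [|n IH] x h.
  by have := rc0; congr P; apply/funext => r; apply/funext => b; rewrite big_ord0.
have := rcD (IH (fun i => x (widen_ord (leqnSn n) i)) (fun i => h _)) (h ord_max).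
by congr P; apply/funext => r; apply/funext => b; rewrite big_ord_recr.
Qed.

Lemma rc_shiftn n x : P x -> P (fun r b => x r (b - n%:R)).
Proof.
elim: n => [|n IH] hx.
  by move: hx; congr P; apply/funext => r; apply/funext => b; rewrite subr0.
have := rc_shift hP (IH hx); congr P; apply/funext => r; apply/funext => b.
by rewrite -natr1; congr x; ring.
Qed.

End ClosedTheory.

(** Multiplication by [small ^ n].  With [n] the total degree of the vectors,
    it turns the homogeneous coefficients of the reduction relations, of the
    form [small^-i] or [large^-i (1 - s t)^-i], into elements of
    [C[t, (1 - s t)^-1]]. *)
Definition twist (n : nat) (x : fam) : fam := fun r b => x (r - n%:R) (b - n%:R).

Lemma trunc_twist n x : trunc x -> trunc (twist n x).
Proof.
move=> [N h]; exists N => r b hb; rewrite /twist h // ReB Re_nat.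
by have : (0:R) <= n%:R by []; lra.
Qed.

Variables (A B C : vmodule V) (gA : nat -> set A) (gB : nat -> set B)
  (gC : nat -> set C) (s : CC) (F : A -> B -> C -> fam).
Hypotheses (hgA : is_grading gA) (hgB : is_grading gB) (hgC : is_grading gC).
Hypotheses (cofA : C1_cofinite A) (cofB : C1_cofinite B) (cofC : C1_cofinite C).

Definition homog (N : nat) v u w : Prop :=
  exists l m n, [/\ gA l v, gB m u, gC n w & N = (l + m + n)%N].

Definition below (P : fam -> Prop) (N : nat) : Prop := forall N' v u w,
  (N' < N)%N -> homog N' v u w -> P (twist N' (F v u w)).

(** The relations [red_A], [red_B] and [red_C] express a correlator with
    [a_{-1}] in one slot through correlators of lower total degree;
    [red_small] and [red_total] are the two differential equations, the second
    one multiplied by [t]. *)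
Record reducible : Prop := Reducible {
  red_linA : forall a v v' u w r b,
    F (a *: v + v') u w r b = a * F v u w r b + F v' u w r b;
  red_linB : forall a v u u' w r b,
    F v (a *: u + u') w r b = a * F v u w r b + F v u' w r b;
  red_linC : forall a v u w w' r b,
    F v u (a *: w + w') r b = a * F v u w r b + F v u w' r b;
  red_trunc : forall v u w, trunc (F v u w);
  red_A : forall P, reg_closed s P -> forall (d : nat) (a : V) N v u w,
    (0 < d)%N -> vgr d%:Z a -> homog N v u w -> below P (N + d) ->
    P (twist (N + d) (F (mmode a (-1) v) u w));
  red_B : forall P, reg_closed s P -> forall (d : nat) (a : V) N v u w,
    (0 < d)%N -> vgr d%:Z a -> homog N v u w -> below P (N + d) ->
    P (twist (N + d) (F v (mmode a (-1) u) w));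
  red_C : forall P, reg_closed s P -> forall (d : nat) (a : V) N v u w,
    (0 < d)%N -> vgr d%:Z a -> homog N v u w -> below P (N + d) ->
    P (twist (N + d) (F v u (mmode a (-1) w)));
  red_small : forall P, reg_closed s P -> (forall N, below P N) ->
    forall N v u w, homog N v u w ->
    P (fun r b => b * twist N (F v u w) r b);
  red_total : forall P, reg_closed s P -> (forall N, below P N) ->
    forall N v u w, homog N v u w ->
    P (fun r b => r * twist N (F v u w) r (b - 1)) }.

Lemma good_untwist n x : good (twist n x) -> good x.
Proof.
move=> /(good_shift (- n%:R) (- n%:R)); congr good.
by apply/funext => r; apply/funext => b; rewrite /twist !opprK !addrK.
Qed.

(** By induction on the total degree, first reducing [v], then [u], then [w],
    all correlators lie in the span of those of generators, and the
    differential equations restricted to these form a regular singular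
    system. *)
Theorem reducible_good : Normc.normc s <= 1 -> 1 - s * 2 != 0 ->
  reducible -> forall v u w, good (F v u w).
Proof.
move=> s1 s2 [linA linB linC tr rA rB rC rS rT].
have [LA hLA genA] := C1_generators hgA cofA.
have [LB hLB genB] := C1_generators hgB cofB.
have [LC hLC genC] := C1_generators hgC cofC.
pose L := [seq (p, q) | p <- LA, q <- [seq (p, q) | p <- LB, q <- LC]].
pose E (t : (nat * A) * ((nat * B) * (nat * C))) :=
  twist (t.1.1 + t.2.1.1 + t.2.2.1) (F t.1.2 t.2.1.2 t.2.2.2).
pose e i := E (tnth (in_tuple L) i).
have homL t : t \in L -> homog (t.1.1 + t.2.1.1 + t.2.2.1) t.1.2 t.2.1.2 t.2.2.2.
  move=> /allpairsP[[p q] [/hLA gp /allpairsP[[p' q'] [/hLB gp' /hLC gq' ->]] ->]].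
  by exists p.1, p'.1, q'.1.
have genL t : t \in L -> regspan s e (E t).
  by move=> /(tnthP (in_tuple L)) [i ->]; exact: regspan_gen.
have cl := regspan_closed s e.
have lin0 (Q : fam -> Prop) (hQ : Q (fun _ _ => 0)) x : (forall r b, x r b = 0) -> Q x.
  by move=> h; rewrite (_ : x = fun _ _ => 0) //; apply/funext => r; apply/funext => b.
have F0A u w r b : F 0 u w r b = 0.
  by have := linA (-1) 0 0 u w r b; rewrite scaler0 addr0 mulN1r addNr.
have F0B v w r b : F v 0 w r b = 0.
  by have := linB (-1) v 0 0 w r b; rewrite scaler0 addr0 mulN1r addNr.
have F0C v u r b : F v u 0 r b = 0.
  by have := linC (-1) v u 0 0 r b; rewrite scaler0 addr0 mulN1r addNr.
have span N v u w : homog N v u w -> regspan s e (twist N (F v u w)).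
  elim/ltn_ind: N v u w => N IH v u w [l [m [n [gv gu gw NE]]]].
  have bel : below (regspan s e) N by move=> N' v' u' w' /IH h /h.
  have splitl d k : (0 < d <= k)%N -> k = (k - d + d)%N.
    by move=> /andP[_ /subnK].
  apply: (genA l (fun v => regspan s e (twist N (F v u w)))) gv.
  - by apply: (lin0 _ (rc0 cl)) => r b; rewrite /twist F0A.
  - move=> a x y hx hy; have := regspan_lin a hx hy; congr regspan.
    by apply/funext => r; apply/funext => b; rewrite /twist linA.
  - move=> {}v vL.
    apply: (genB m (fun u => regspan s e (twist N (F v u w)))) gu.
    + by apply: (lin0 _ (rc0 cl)) => r b; rewrite /twist F0B.
    + move=> a x y hx hy; have := regspan_lin a hx hy; congr regspan.
      by apply/funext => r; apply/funext => b; rewrite /twist linB.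
    + move=> {}u uL.
      apply: (genC n (fun w => regspan s e (twist N (F v u w)))) gw.
      * by apply: (lin0 _ (rc0 cl)) => r b; rewrite /twist F0C.
      * move=> a x y hx hy; have := regspan_lin a hx hy; congr regspan.
        by apply/funext => r; apply/funext => b; rewrite /twist linC.
      * move=> {}w wL; rewrite NE.
        apply: (genL ((l, v), ((m, u), (n, w)))).
        by apply: allpairs_f => //; apply: allpairs_f.
      * move=> d a x hd ha gx; have dE := splitl _ _ hd.
        have NE' : N = (l + m + (n - d) + d)%N by rewrite NE [in LHS]dE !addnA.
        rewrite NE' in bel *; apply: rC => //; first by case/andP: hd.
        by exists l, m, (n - d)%N; split => //; [exact: (hLA _ vL) | exact: (hLB _ uL)].
    + move=> d a x hd ha gx; have dE := splitl _ _ hd.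
      have NE' : N = (l + (m - d) + n + d)%N.
        by rewrite NE [in LHS]dE addnA -!addnA (addnC d).
      rewrite NE' in bel *; apply: rB => //; first by case/andP: hd.
      by exists l, (m - d)%N, n; split => //; exact: (hLA _ vL).
  - move=> d a x hd ha gx; have dE := splitl _ _ hd.
    have NE' : N = ((l - d) + m + n + d)%N.
      by rewrite NE [in LHS]dE -!addnA (addnC d) !addnA.
    rewrite NE' in bel *; apply: rA => //; first by case/andP: hd.
    by exists (l - d)%N, m, n.
have goodH N v u w : homog N v u w -> good (F v u w).
  move=> h; apply: (@good_untwist N).
  apply: (regspan_is_good s1 s2 (e := e)); last exact: span.
  - by move=> i; apply: trunc_twist; exact: tr.
  - move=> i; apply: (rT _ cl) => [M N' v' u' w' _ /span //|].
    by apply: homL; rewrite mem_tnth.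
  - move=> i; apply: (rS _ cl) => [M N' v' u' w' _ /span //|].
    by apply: homL; rewrite mem_tnth.
  - by apply: trunc_twist; exact: tr.
have extend (W : lmodType CC) (g : nat -> set W) (G : W -> fam) :
    direct_sum g -> (forall a x y r b, G (a *: x + y) r b = a * G x r b + G y r b) ->
    (forall d x, g d x -> good (G x)) -> forall x, good (G x).
  move=> dg linG hG x; have [L' hL' ->] := pieces_homog dg x.
  have G0 r b : G 0 r b = 0.
    by have := linG (-1) 0 0 r b; rewrite scaler0 addr0 mulN1r addNr.
  elim: L' hL' => [_|p L' IH hL'].
    by rewrite big_nil; apply: (lin0 _ (@good0 _)).
  rewrite big_cons -[p.2]scale1r.
  have gp : good (G p.2) by apply: hG (hL' p _); rewrite mem_head.
  have gL' : good (G (\sum_(q <- L') q.2)).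
    by apply: IH => q qL; apply: hL'; rewrite inE qL orbT.
  have := good_lin 1 gp gL'; congr good.
  by apply/funext => r; apply/funext => b; rewrite linG.
move=> v u w.
apply: (extend _ gA (fun v => F v u w)) => [|a x y r b|l {}v gv]; first by case: hgA.
  exact: linA.
apply: (extend _ gB (fun u => F v u w)) => [|a x y r b|m {}u gu]; first by case: hgB.
  exact: linB.
apply: (extend _ gC (fun w => F v u w)) => [|a x y r b|n {}w gw]; first by case: hgC.
  exact: linC.
by apply: (goodH (l + m + n)%N); exists l, m, n.
Qed.

End Reduction.

(** * Commutator and iterate formulas as finite sums *)

Section Binomials.
Variable K : numFieldType.

Lemma binzS (m : int) j :
  j.+1%:R * binz K m j.+1 = (m - j%:Z)%:~R * binz K m j.
Proof.
have cancel (y f p x : K) : y != 0 -> f != 0 -> y * (p * x / (y * f)) = x * (p / f).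
  by move=> y0 f0; field; rewrite y0 f0.
rewrite /binz big_ord_recr /= factS natrM cancel //.
Qed.

Lemma binz0 (m : int) : binz K m 0 = 1.
Proof. by rewrite /binz big_ord0 fact0 divr1. Qed.

Lemma binz_nat n j : binz K n%:Z j = 'C(n, j)%:R.
Proof.
elim: j => [|j IH]; first by rewrite binz0 bin0.
have j0 : j.+1%:R != 0 :> K by rewrite pnatr_eq0.
apply: (mulfI j0); rewrite binzS IH -natrM mul_bin_left natrM.
have [nj|jn] := ltnP n j; first by rewrite bin_small // !mulr0.
by rewrite subzn // natrB.
Qed.

Lemma binz_neg n j : binz K (Negz n) j = (-1) ^+ j * 'C(j + n, j)%:R.
Proof.
elim: j => [|j IH]; first by rewrite binz0 bin0 mul1r.
have j0 : j.+1%:R != 0 :> K by rewrite pnatr_eq0.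
apply: (mulfI j0); rewrite binzS IH [in RHS]mulrCA -natrM addSn -mul_bin_diag natrM.
rewrite (_ : Negz n - j%:Z = - (j + n).+1%:Z); last first.
  by rewrite NegzE -opprD -PoszD addSn addnC.
by rewrite intrN exprS mulN1r !mulNr mulrCA.
Qed.

End Binomials.

Lemma sum_bin_shift (K : pzRingType) (f : nat -> K) i n : (i <= n)%N ->
  \sum_(j < n) 'C(j, i)%:R * f j = \sum_(l < n - i) 'C(l + i, i)%:R * f (l + i)%N.
Proof.
move=> /subnKC; move: (n - i)%N => m <-; rewrite big_split_ord /= big1 => [|j _].
  by rewrite add0r; apply: eq_bigr => l _; rewrite addnC.
by rewrite bin_small ?mul0r.
Qed.

Lemma sum_truncate (U : nmodType) (f : nat -> U) m n : (m <= n)%N ->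
  (forall j, (m <= j)%N -> f j = 0) -> \sum_(j < n) f j = \sum_(j < m) f j.
Proof.
move=> /subnKC <- h; rewrite big_split_ord /=.
rewrite [X in (_ + X)%R = _]big1 ?addr0 // => j _.
by rewrite h // leq_addr.
Qed.

Lemma eventually_ord n (P : 'I_n -> nat -> Prop) :
  (forall i, exists m, forall j, (m <= j)%N -> P i j) ->
  exists m, forall j, (m <= j)%N -> forall i, P i j.
Proof.
move=> /fin_all_exists [m hm]; exists (\max_i m i)%N => j hj i.
by apply: hm; apply: leq_trans hj; exact: leq_bigmax.
Qed.

Section Intertwiner.
Variables (R : realType) (V : voa R).
Local Notation CC := (R[i]).

Lemma mmode_eventually0 (W : vmodule V) (a : V) (w : W) :
  exists n : nat, forall j : nat, (n <= j)%N -> mmode a j%:Z w = 0.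
Proof.
have [N h] := mmode_trunc a w; exists `|N|%N => j hj; apply: h.
by apply: (le_trans (ler_norm N)); rewrite -abszE lez_nat.
Qed.

Variables (A B D : vmodule V) (Y : log_intertwiner A B D).

Lemma lio_linl h s u c x y : Y h (c *: x + y) s u = c *: Y h x s u + Y h y s u.
Proof. exact: (lio_linearl Y h s u). Qed.

Lemma lio0l h s u : Y h 0 s u = 0.
Proof. by have := lio_linl h s u (-1) 0 0; rewrite scaler0 addr0 scaleN1r addNr. Qed.

Lemma lioDl h s u x y : Y h (x + y) s u = Y h x s u + Y h y s u.
Proof. by rewrite -[x in LHS]scale1r lio_linl scale1r. Qed.

Lemma lioZl h s u c x : Y h (c *: x) s u = c *: Y h x s u.
Proof. by rewrite -[_ *: x]addr0 lio_linl lio0l addr0. Qed.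

Lemma lioNl h s u x : Y h (- x) s u = - Y h x s u.
Proof. by rewrite -scaleN1r lioZl scaleN1r. Qed.

Lemma lio_suml h s u I (t : seq I) (x : I -> A) :
  Y h (\sum_(i <- t) x i) s u = \sum_(i <- t) Y h (x i) s u.
Proof.
apply: (big_morph (fun v => Y h v s u)) => [v v'|]; [exact: lioDl|exact: lio0l].
Qed.

Lemma lio_eventually0 h v s u :
  exists n : nat, forall j : nat, (n <= j)%N -> Y h v (s + j%:R) u = 0.
Proof.
have [N hN] := lio_trunc Y v u.
exists (Num.Def.truncn `|N - complex.Re s|).+1 => j hj; apply: hN.
rewrite ReD Re_nat; move: hj; rewrite -(ler_nat R).
have := truncnS_gt `|N - complex.Re s|; have := ler_norm (N - complex.Re s).
by lra.
Qed.

(** In the next three lemmas the number of terms is any sufficiently large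
    number, so that sums of such formulas can be exchanged.  Recall that
    [Negz n] is [- n - 1]. *)
Lemma lio_comm_nat n0 (a : V) (n : nat) h v s u :
  (forall j : nat, (n0 <= j)%N -> mmode a j%:Z v = 0) ->
  mmode a n%:Z (Y h v s u) = Y h v s (mmode a n%:Z u) +
    \sum_(j < n0) 'C(n, j)%:R *: Y h (mmode a j%:Z v) (s + n%:R - j%:R) u.
Proof.
move=> v0; apply/eqP; rewrite addrC -subr_eq; apply/eqP.
rewrite lio_comm (@fsum_nat _ _ n0) => [|j /v0 ->]; last by rewrite lio0l scaler0.
by apply: eq_bigr => j _; rewrite binz_nat.
Qed.

Lemma lio_comm_neg n0 (a : V) (n : nat) h v s u :
  (forall j : nat, (n0 <= j)%N -> mmode a j%:Z v = 0) ->
  Y h v s (mmode a (Negz n) u) = mmode a (Negz n) (Y h v s u) -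
    \sum_(j < n0) ((-1) ^+ j * 'C(j + n, j)%:R) *:
      Y h (mmode a j%:Z v) (s - n.+1%:R - j%:R) u.
Proof.
move=> v0; apply/eqP; rewrite eq_sym subr_eq addrC -subr_eq; apply/eqP.
rewrite lio_comm (@fsum_nat _ _ n0) => [|j /v0 ->]; last by rewrite lio0l scaler0.
by apply: eq_bigr => j _; rewrite binz_neg NegzE intrN.
Qed.

Lemma lio_iter_neg (a : V) (n : nat) h v s u : exists m0 : nat, forall m, (m0 <= m)%N ->
  Y h (mmode a (Negz n) v) s u = \sum_(j < m) 'C(j + n, j)%:R *:
    (mmode a (Negz (n + j)) (Y h v (s + j%:R) u) +
     (-1) ^+ n *: Y h v (s - n.+1%:R - j%:R) (mmode a j%:Z u)).
Proof.
have [n1 h1] := lio_eventually0 h v s u; have [n2 h2] := mmode_eventually0 a u.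
exists (maxn n1 n2) => m; rewrite geq_max => /andP[m1 m2].
rewrite lio_iter (@fsum_nat _ _ m) => [|j jm]; last first.
  by rewrite h1 ?(leq_trans m1) // h2 ?(leq_trans m2) // !raddf0 addr0 scaler0.
apply: eq_bigr => j _.
rewrite binz_neg mulrAC -exprD addnn -mul2n exprM sqrrN !expr1n mul1r.
rewrite (_ : Negz n - j%:Z = Negz (n + j)); last first.
  by rewrite !NegzE -opprD -PoszD addSn.
congr (_ *: (_ + _)).
rewrite NegzE intrN -scaleNr; congr (_ *: _).
rewrite -exprnN exprS invrM ?unitrN1 ?unitrX ?unitrN1 // invrN1 mulrN1 opprK.
by rewrite -exprVn invrN1.
Qed.

Lemma lio_translation h v s u :
  mmode (vconf V) 0 (Y h v s u) =
  Y h (mmode (vconf V) 0 v) s u + Y h v s (mmode (vconf V) 0 u).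
Proof.
apply/eqP; rewrite -subr_eq lio_comm (@fsum_nat _ _ 1) => [|[|j] //].
  rewrite big_ord1 binz0 scale1r.
  rewrite (_ : s + _ - _ = s) //.
  by rewrite mulr0z !addr0 /= subr0.
by rewrite (binz_nat _ 0) bin_small // scale0r.
Qed.

End Intertwiner.

(** * Products of intertwining operators *)

Section ModeDegrees.
Variables (R : realType) (V : voa R) (W : vmodule V) (g : nat -> set W).
Hypothesis gg : is_grading g.
Variables (d m : nat) (a : V) (w : W).
Hypotheses (ha : vgr d%:Z a) (gw : g m w).

Lemma mode_vanish (j : nat) : (m + d <= j)%N -> mmode a j%:Z w = 0.
Proof. by move=> h; apply: (homog_mode0 gg ha gw); lia. Qed.

Lemma mode_homog (j : nat) : (j < m + d)%N -> g (m + d - j.+1)%N (mmode a j%:Z w).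
Proof. by move=> h; apply: (homog_mode gg ha gw); lia. Qed.

End ModeDegrees.

Section Product.
Variables (R : realType) (V : voa R) (A B C BC D : vmodule V).
Variables (Y1 : log_intertwiner A BC D) (Y2 : log_intertwiner B C BC).
Local Notation CC := (R[i]).

(** With [x] large and [y] small, [a = r - b] is the exponent of [x]. *)
Definition prodfam (theta : {scalar D}) h k (v : A) (u : B) (w : C) :
    CC -> CC -> CC :=
  fun r b => theta (Y1 h v (b - r - 1) (Y2 k u (- b - 1) w)).

Variables (gA : nat -> set A) (gB : nat -> set B) (gC : nat -> set C).
Hypotheses (hgA : is_grading gA) (hgB : is_grading gB) (hgC : is_grading gC).
Variables (theta : {scalar D}) (h k M : nat).
(* [theta \o mmode a (Negz n)] has lower degree than [theta], and the
   logarithmic degrees are bounded, so that the following hold by induction. *)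
Hypothesis theta_low : forall (d : nat) (a : V) n v u w, (0 < d)%N ->
  vgr d%:Z a -> good (prodfam (theta \o mmode a (Negz n)) h k v u w).
Hypothesis theta_vanish : forall (d : nat) (a : V) n x, (0 < d)%N ->
  vgr d%:Z a -> (M <= n)%N -> theta (mmode a (Negz n) x) = 0.
Hypothesis log1 : forall v u w, good (prodfam theta h.+1 k v u w).
Hypothesis log2 : forall v u w, good (prodfam theta h k.+1 v u w).

Let c v u w s1 s2 := theta (Y1 h v s1 (Y2 k u s2 w)).
Let F := prodfam theta h k.

Lemma prodfam_trunc v u w : trunc (F v u w).
Proof.
have [N hN] := lio_trunc Y2 u w; exists (- N - 1) => r b hb.
rewrite /F /prodfam hN ?raddf0 ?raddf0 //.
by rewrite ReB ReN /=; lra.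
Qed.

(** The iterate formula moves [a_{-1}] off [v]; its nonnegative modes are then
    commuted past the inner operator.  The sum over [j] of the last term is the
    expansion of [(x - y)^-(i+1)] in [|x| > |y|]. *)
Lemma prodfam_expand1 (a : V) nu v u w s1 s2 :
  (forall j : nat, (nu <= j)%N -> mmode a j%:Z u = 0) ->
  exists m0 : nat, forall J, (m0 <= J)%N -> c (mmode a (-1) v) u w s1 s2 =
    \sum_(j < J) theta (mmode a (Negz j) (Y1 h v (s1 + j%:R) (Y2 k u s2 w))) +
    (\sum_(j < J) c v u (mmode a j%:Z w) (s1 - 1 - j%:R) s2 +
     \sum_(i < nu) \sum_(j < J) 'C(j, i)%:R *
       c v (mmode a i%:Z u) w (s1 - 1 - j%:R) (s2 + j%:R - i%:R)).
Proof.
move=> u0; have [m0 hm0] := lio_iter_neg Y1 a 0 h v s1 (Y2 k u s2 w).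
exists m0 => J /hm0; rewrite /c => ->.
rewrite raddf_sum exchange_big /= -!big_split /=; apply: eq_bigr => j _.
rewrite addn0 binn scale1r expr0 scale1r raddfD /=; congr (_ + _).
rewrite (lio_comm_nat _ _ _ _ _ u0) !raddfD /=; congr (_ + _).
rewrite !raddf_sum /=; apply: eq_bigr => i _.
by rewrite !linearZ.
Qed.

(** The iterate formula for the inner operator; its negative modes are then
    commuted past the outer operator, which again produces [(x - y)^-(i+1)]. *)
Lemma prodfam_expand2 (a : V) nv v u w s1 s2 :
  (forall j : nat, (nv <= j)%N -> mmode a j%:Z v = 0) ->
  exists m0 : nat, forall J, (m0 <= J)%N -> c v (mmode a (-1) u) w s1 s2 =
    \sum_(j < J) theta (mmode a (Negz j) (Y1 h v s1 (Y2 k u (s2 + j%:R) w))) +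
    (\sum_(j < J) c v u (mmode a j%:Z w) s1 (s2 - 1 - j%:R) -
     \sum_(i < nv) \sum_(j < J) ((-1) ^+ i * 'C(j + i, i)%:R) *
       c (mmode a i%:Z v) u w (s1 - j.+1%:R - i%:R) (s2 + j%:R)).
Proof.
move=> v0; have [m0 hm0] := lio_iter_neg Y2 a 0 k u s2 w.
exists m0 => J /hm0; rewrite /c => ->.
rewrite 2!raddf_sum exchange_big /= -sumrB -big_split /=; apply: eq_bigr => j _.
rewrite addn0 binn scale1r expr0 scale1r !raddfD /=.
rewrite (lio_comm_neg _ _ _ _ _ v0) raddfB /= -!addrA; congr (_ + _).
rewrite addrC; congr (_ - _).
rewrite raddf_sum /=; apply: eq_bigr => i _.
by rewrite linearZ /= addnC.
Qed.

(** Here [a_{-1}] is commuted to the left past both operators. *)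
Lemma prodfam_expand3 (a : V) nv nu v u w s1 s2 :
  (forall j : nat, (nv <= j)%N -> mmode a j%:Z v = 0) ->
  (forall j : nat, (nu <= j)%N -> mmode a j%:Z u = 0) ->
  c v u (mmode a (-1) w) s1 s2 =
    theta (mmode a (Negz 0) (Y1 h v s1 (Y2 k u s2 w))) +
    (- \sum_(i < nv) (-1) ^+ i * c (mmode a i%:Z v) u w (s1 - 1 - i%:R) s2
     - \sum_(i < nu) (-1) ^+ i * c v (mmode a i%:Z u) w s1 (s2 - 1 - i%:R)).
Proof.
move=> v0 u0; rewrite /c (lio_comm_neg _ 0 _ _ _ u0) raddfB raddfB /=.
rewrite (lio_comm_neg _ 0 _ _ _ v0) raddfB /= -addrA; congr (_ + (- _ - _)).
  rewrite raddf_sum /=; apply: eq_bigr => i _.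
  by rewrite linearZ /= addn0 binn mulr1.
rewrite !raddf_sum /=; apply: eq_bigr => i _.
by rewrite !linearZ /= addn0 binn mulr1.
Qed.

Lemma prodfam_deriv2 v u w s1 s2 : c v (mmode (vconf V) 0 u) w s1 s2 =
  - s2 * c v u w s1 (s2 - 1) + k.+1%:R * theta (Y1 h v s1 (Y2 k.+1 u (s2 - 1) w)).
Proof. by rewrite /c lio_deriv !raddfD /= !linearZ /=. Qed.

Lemma prodfam_deriv1 v u w s1 s2 : c (mmode (vconf V) 0 v) u w s1 s2 =
  - s1 * c v u w (s1 - 1) s2 + h.+1%:R * theta (Y1 h.+1 v (s1 - 1) (Y2 k u s2 w)).
Proof. by rewrite /c lio_deriv raddfD /= !linearZ /=. Qed.

Section Relations.
Variable P : (CC -> CC -> CC) -> Prop.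
Hypothesis hP : reg_closed 1 P.

Section Modes.
Variables (d : nat) (a : V) (l m n : nat) (v : A) (u : B) (w : C).
Hypotheses (d0 : (0 < d)%N) (ha : vgr d%:Z a).
Hypotheses (gv : gA l v) (gu : gB m u) (gw : gC n w).
Let N := (l + m + n)%N.
Hypothesis bel : below gA gB gC F P (N + d).

Let vj j := @mode_vanish _ _ _ _ hgA _ _ _ _ ha gv j.
Let uj j := @mode_vanish _ _ _ _ hgB _ _ _ _ ha gu j.
Let wj j := @mode_vanish _ _ _ _ hgC _ _ _ _ ha gw j.

Lemma below1 (j : nat) : (j < l + d)%N ->
  P (twist (N + d - j.+1) (F (mmode a j%:Z v) u w)).
Proof.
move=> hj; apply: bel; first by rewrite /N; lia.
exists (l + d - j.+1)%N, m, n; split => //; last by rewrite /N; lia.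
exact: (mode_homog hgA ha gv hj).
Qed.

Lemma below2 (j : nat) : (j < m + d)%N ->
  P (twist (N + d - j.+1) (F v (mmode a j%:Z u) w)).
Proof.
move=> hj; apply: bel; first by rewrite /N; lia.
exists l, (m + d - j.+1)%N, n; split => //; last by rewrite /N; lia.
exact: (mode_homog hgB ha gu hj).
Qed.

Lemma below3 (j : nat) : (j < n + d)%N ->
  P (twist (N + d - j.+1) (F v u (mmode a j%:Z w))).
Proof.
move=> hj; apply: bel; first by rewrite /N; lia.
exists l, m, (n + d - j.+1)%N; split => //; last by rewrite /N; lia.
exact: (mode_homog hgC ha gw hj).
Qed.

Lemma prodfam_red1 : P (twist (N + d) (F (mmode a (-1) v) u w)).
Proof.
pose low (j : nat) := prodfam (theta \o mmode a (Negz j)) h k v u w.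
pose x (i : nat) := twist (N + d - i.+1) (F v (mmode a i%:Z u) w).
have tx i : trunc (x i) by apply: trunc_twist; exact: prodfam_trunc.
rewrite (_ : twist _ _ = fun r b =>
  \sum_(j < M) low j (r - (N + d)%:R - j%:R) (b - (N + d)%:R) +
  (\sum_(j < n + d) twist (N + d - j.+1) (F v u (mmode a j%:Z w)) r (b - j.+1%:R) +
   \sum_(i < m + d) invpow 1 i (x i) r (b - i.+1%:R))); last first.
  apply/funext => r; apply/funext => b.
  pose b' := b - (N + d)%:R; pose r' := r - (N + d)%:R.
  have [m0 hm0] := @prodfam_expand1 a _ v u w (b' - r' - 1) (- b' - 1) uj.
  have [m1 hm1] := eventually_ord
    (fun i : 'I_(m + d) => trunc_nat r (b - i.+1%:R) (tx i)).
  pose J := (m0 + M + (n + d) + (m1 + (m + d)))%N.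
  rewrite [LHS](hm0 J) /c; last by rewrite /J; lia.
  congr (_ + (_ + _)).
  - rewrite (@sum_truncate _ (fun j : nat => theta (mmode a (Negz j)
      (Y1 h v (b' - r' - 1 + j%:R) (Y2 k u (- b' - 1) w)))) M) => [||j Mj]; first last.
    + by rewrite (theta_vanish _ d0 ha).
    + by rewrite /J; lia.
    apply: eq_bigr => j _; rewrite /low /prodfam /=.
    by congr (theta (mmode _ _ (Y1 _ _ _ _))); rewrite /b' /r'; ring.
  - rewrite (@sum_truncate _ (fun j : nat => theta (Y1 h v (b' - r' - 1 - 1 - j%:R)
      (Y2 k u (- b' - 1) (mmode a j%:Z w)))) (n + d)) => [||j hj]; first last.
    + by rewrite wj // !raddf0.
    + by rewrite /J; lia.
    apply: eq_bigr => -[j hj] _; rewrite /twist /F /prodfam /= natrB; last by lia.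
    by congr (theta (Y1 _ _ _ (Y2 _ _ _ _))); rewrite /b' /r'; ring.
  - apply: eq_bigr => -[i hi] _.
    rewrite (@invpow_finite _ _ _ _ _ _ (J - i)) => [|j hj]; last first.
      by rewrite (hm1 _ _ (Ordinal hi)) //; move: hj; rewrite /J; lia.
    rewrite (@sum_bin_shift _ (fun j : nat => theta (Y1 h v (b' - r' - 1 - 1 - j%:R)
      (Y2 k (mmode a i%:Z u) (- b' - 1 + j%:R - i%:R) w)))) /=; last by rewrite /J; lia.
    apply: eq_bigr => j _; rewrite expr1n mulr1; congr (_ * _).
    rewrite /x /twist /F /prodfam /= natrB; last by lia.
    by congr (theta (Y1 _ _ _ (Y2 _ _ _ _))); rewrite /b' /r' !natrD; ring.
apply: (rcD hP).
  apply: (rc_sum hP) => j; apply: (rc_good hP).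
  have := good_shift ((N + d)%:R + j%:R) (N + d)%:R (theta_low j v u w d0 ha).
  by congr good; apply/funext => r; apply/funext => b; rewrite opprD addrA.
apply: (rcD hP); apply: (rc_sum hP) => -[j hj].
  by apply: (rc_shiftn hP j.+1); exact: below3.
apply: (rc_shiftn hP j.+1 (x := invpow 1 j (x j))).
by apply: (rc_invpow hP) => //; exact: below2.
Qed.

Lemma prodfam_red2 : P (twist (N + d) (F v (mmode a (-1) u) w)).
Proof.
pose low (j : nat) := prodfam (theta \o mmode a (Negz j)) h k v u w.
pose x (i : nat) := twist (N + d - i.+1) (F (mmode a i%:Z v) u w).
have tx i : trunc (x i) by apply: trunc_twist; exact: prodfam_trunc.
rewrite (_ : twist _ _ = fun r b =>
  \sum_(j < M) low j (r - (N + d)%:R - j%:R) (b - (N + d)%:R - j%:R) +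
  (\sum_(j < n + d) twist (N + d - j.+1) (F v u (mmode a j%:Z w)) r b -
   \sum_(i < l + d) (-1) ^+ i * invpow 1 i (x i) r (b - i.+1%:R))); last first.
  apply/funext => r; apply/funext => b.
  pose b' := b - (N + d)%:R; pose r' := r - (N + d)%:R.
  have [m0 hm0] := @prodfam_expand2 a _ v u w (b' - r' - 1) (- b' - 1) vj.
  have [m1 hm1] := eventually_ord
    (fun i : 'I_(l + d) => trunc_nat r (b - i.+1%:R) (tx i)).
  pose J := (m0 + M + (n + d) + m1)%N.
  rewrite [LHS](hm0 J) /c; last by rewrite /J; lia.
  congr (_ + (_ - _)).
  - rewrite (@sum_truncate _ (fun j : nat => theta (mmode a (Negz j)
      (Y1 h v (b' - r' - 1) (Y2 k u (- b' - 1 + j%:R) w)))) M) => [||j Mj]; first last.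
    + by rewrite (theta_vanish _ d0 ha).
    + by rewrite /J; lia.
    apply: eq_bigr => j _; rewrite /low /prodfam /=.
    by congr (theta (mmode _ _ (Y1 _ _ _ (Y2 _ _ _ _)))); rewrite /b' /r'; ring.
  - rewrite (@sum_truncate _ (fun j : nat => theta (Y1 h v (b' - r' - 1)
      (Y2 k u (- b' - 1 - 1 - j%:R) (mmode a j%:Z w)))) (n + d)) => [||j hj]; first last.
    + by rewrite wj // !raddf0.
    + by rewrite /J; lia.
    apply: eq_bigr => -[j hj] _; rewrite /twist /F /prodfam /= natrB; last by lia.
    by congr (theta (Y1 _ _ _ (Y2 _ _ _ _))); rewrite /b' /r'; ring.
  - apply: eq_bigr => -[i hi] _.
    rewrite (@invpow_finite _ _ _ _ _ _ J) => [|j hj]; last first.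
      by rewrite (hm1 _ _ (Ordinal hi)) //; move: hj; rewrite /J; lia.
    rewrite mulr_sumr; apply: eq_bigr => j _.
    rewrite expr1n mulr1 mulrA; congr (_ * _).
    rewrite /x /twist /F /prodfam /= natrB; last by lia.
    by congr (theta (Y1 _ _ _ (Y2 _ _ _ _))); rewrite /b' /r'; ring.
apply: (rcD hP).
  apply: (rc_sum hP) => j; apply: (rc_good hP).
  have := good_shift ((N + d)%:R + j%:R) ((N + d)%:R + j%:R) (theta_low j v u w d0 ha).
  by congr good; apply/funext => r; apply/funext => b; rewrite !opprD !addrA.
apply: (rcB hP); apply: (rc_sum hP) => -[j hj]; first exact: below3.
apply: (rcZ hP); apply: (rc_shiftn hP j.+1 (x := invpow 1 j (x j))).
by apply: (rc_invpow hP) => //; exact: below1.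
Qed.

Lemma prodfam_red3 : P (twist (N + d) (F v u (mmode a (-1) w))).
Proof.
pose low := prodfam (theta \o mmode a (Negz 0)) h k v u w.
rewrite (_ : twist _ _ = fun r b => low (r - (N + d)%:R) (b - (N + d)%:R) +
  (\sum_(i < l + d) (-1) ^+ i.+1 *
      twist (N + d - i.+1) (F (mmode a i%:Z v) u w) r (b - i.+1%:R) +
   \sum_(i < m + d) (-1) ^+ i.+1 *
      twist (N + d - i.+1) (F v (mmode a i%:Z u) w) r b)); last first.
  apply/funext => r; apply/funext => b.
  rewrite [LHS](prodfam_expand3 _ _ _ vj uj) /c -!sumrN; congr (_ + (_ + _)).
    apply: eq_bigr => -[i hi] _; rewrite exprS mulN1r mulNr; congr (- (_ * _)).
    rewrite /twist /F /prodfam /= natrB; last by lia.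
    by congr (theta (Y1 _ _ _ (Y2 _ _ _ _))); ring.
  apply: eq_bigr => -[i hi] _; rewrite exprS mulN1r mulNr; congr (- (_ * _)).
  rewrite /twist /F /prodfam /= natrB; last by lia.
  by congr (theta (Y1 _ _ _ (Y2 _ _ _ _))); ring.
apply: (rcD hP).
  by apply: (rc_good hP); apply: good_shift; exact: (theta_low _ _ _ _ d0 ha).
apply: (rcD hP); apply: (rc_sum hP) => -[j hj]; apply: (rcZ hP); last exact: below2.
by apply: (rc_shiftn hP j.+1); exact: below1.
Qed.

End Modes.

Section Derivatives.
Hypothesis bel : forall N, below gA gB gC F P N.
Variables (N : nat) (v : A) (u : B) (w : C).
Hypothesis hN : homog gA gB gC N v u w.

(** The inner translation [L(-1) u] differentiates in [y], up to a term with one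
    more logarithm. *)
Lemma prodfam_small : P (fun r b => b * twist N (F v u w) r b).
Proof.
have [l [m [n [gv gu gw NE]]]] := hN.
have hL : P (twist N.+1 (F v (mmode (vconf V) 0 u) w)).
  apply: (bel (N := N.+2)); first by [].
  exists l, m.+1, n; split => //; last by rewrite NE; lia.
  by apply: (homog_mode hgB (vgr_conf V) gu); lia.
rewrite (_ : (fun r b => _) = fun r b => N%:R * twist N (F v u w) r b +
  (twist N.+1 (F v (mmode (vconf V) 0 u) w) r b -
   k.+1%:R * twist N (prodfam theta h k.+1 v u w) r b)); last first.
  apply/funext => r; apply/funext => b.
  rewrite [X in _ + (X - _)]prodfam_deriv2 /c /twist /F /prodfam.
  have e1 : b - N.+1%:R - (r - N.+1%:R) - 1 = b - N%:R - (r - N%:R) - 1 by ring.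
  have e2 : - (b - N.+1%:R) - 1 - 1 = - (b - N%:R) - 1 by ring.
  by rewrite e1 e2; ring.
apply: (rcD hP); first by apply: (rcZ hP); apply: (bel (N := N.+1)).
apply: (rcB hP) => //; apply: (rcZ hP); apply: (rc_good hP).
exact: good_shift.
Qed.

(** The outer translation [L(-1) v] differentiates in [x].  As its degree is
    one higher, [twist] makes this [y * d/dx], which is [t] times [x * d/dx]. *)
Lemma prodfam_total : P (fun r b => r * twist N (F v u w) r (b - 1)).
Proof.
have [l [m [n [gv gu gw NE]]]] := hN.
have hL : P (twist N.+1 (F (mmode (vconf V) 0 v) u w)).
  apply: (bel (N := N.+2)); first by [].
  exists l.+1, m, n; split => //; last by rewrite NE; lia.
  by apply: (homog_mode hgA (vgr_conf V) gv); lia.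
rewrite (_ : (fun r b => _) = fun r b => (b - 1) * twist N (F v u w) r (b - 1) +
  (twist N.+1 (F (mmode (vconf V) 0 v) u w) r b -
   h.+1%:R * twist N (prodfam theta h.+1 k v u w) r (b - 1))); last first.
  apply/funext => r; apply/funext => b.
  rewrite [X in _ + (X - _)]prodfam_deriv1 /c /twist /F /prodfam.
  have e1 : b - N.+1%:R - (r - N.+1%:R) - 1 - 1 = b - 1 - N%:R - (r - N%:R) - 1.
    by ring.
  have e2 : - (b - N.+1%:R) - 1 = - (b - 1 - N%:R) - 1 by ring.
  by rewrite e1 e2; ring.
apply: (rcD hP); first exact: (rc_shift hP prodfam_small).
apply: (rcB hP) => //; apply: (rcZ hP).
apply: (rc_shift hP (x := twist N (prodfam theta h.+1 k v u w))).
by apply: (rc_good hP); exact: good_shift.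
Qed.

End Derivatives.
End Relations.

Lemma prodfam_reducible : reducible gA gB gC 1 F.
Proof.
split.
- move=> a v v' u w r b; rewrite /F /prodfam lio_linl.
  by rewrite linearP.
- by move=> a v u u' w r b; rewrite /F /prodfam lio_linl !linearP.
- by move=> a v u w w' r b; rewrite /F /prodfam !linearP.
- exact: prodfam_trunc.
- move=> P hP d a N v u w d0 ha [l [m [n [gv gu gw ->]]]] bel.
  exact: prodfam_red1.
- move=> P hP d a N v u w d0 ha [l [m [n [gv gu gw ->]]]] bel.
  exact: prodfam_red2.
- move=> P hP d a N v u w d0 ha [l [m [n [gv gu gw ->]]]] bel.
  exact: prodfam_red3.
- by move=> P hP bel N v u w hN; exact: prodfam_small.
- by move=> P hP bel N v u w hN; exact: prodfam_total.
Qed.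

End Product.

(** * Iterates of intertwining operators *)

Section Iterate.
Variables (R : realType) (V : voa R) (A B C AB D : vmodule V).
Variables (Y1 : log_intertwiner AB C D) (Y2 : log_intertwiner A B AB).
Local Notation CC := (R[i]).

(** With [y] large and [z = x - y] small, [a = r - b] is the exponent of [y]. *)
Definition iterfam (theta : {scalar D}) h k (v : A) (u : B) (w : C) :
    CC -> CC -> CC :=
  fun r b => theta (Y1 h (Y2 k v (- b - 1) u) (b - r - 1) w).

Variables (gA : nat -> set A) (gB : nat -> set B) (gC : nat -> set C).
Hypotheses (hgA : is_grading gA) (hgB : is_grading gB) (hgC : is_grading gC).
Variables (theta : {scalar D}) (h k M : nat).
Hypothesis theta_low : forall (d : nat) (a : V) n v u w, (0 < d)%N ->
  vgr d%:Z a -> good (iterfam (theta \o mmode a (Negz n)) h k v u w).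
Hypothesis theta_vanish : forall (d : nat) (a : V) n x, (0 < d)%N ->
  vgr d%:Z a -> (M <= n)%N -> theta (mmode a (Negz n) x) = 0.
Hypothesis log1 : forall v u w, good (iterfam theta h.+1 k v u w).
Hypothesis log2 : forall v u w, good (iterfam theta h k.+1 v u w).

Let c v u w s1 s2 := theta (Y1 h (Y2 k v s2 u) s1 w).
Let F := iterfam theta h k.

Lemma iterfam_trunc v u w : trunc (F v u w).
Proof.
have [N hN] := lio_trunc Y2 v u; exists (- N - 1) => r b hb.
rewrite /F /iterfam hN ?lio0l ?raddf0 //.
by rewrite ReB ReN /=; lra.
Qed.

(** The iterate formula is applied to both operators.  The sum over [j] of the
    last term is the expansion of [(y + z)^-(i+1)] in [|y| > |z|]. *)
Lemma iterfam_expand1 (a : V) v u w s1 s2 :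
  exists m0 : nat, forall J, (m0 <= J)%N -> exists m1 : nat, forall I, (m1 <= I)%N ->
  c (mmode a (-1) v) u w s1 s2 =
    \sum_(j < J) \sum_(i < I) 'C(i + j, i)%:R *
      theta (mmode a (Negz (j + i)) (Y1 h (Y2 k v (s2 + j%:R) u) (s1 + i%:R) w)) +
    (\sum_(j < J) c v (mmode a j%:Z u) w s1 (s2 - 1 - j%:R) +
     \sum_(i < I) \sum_(j < J) ('C(j + i, i)%:R * (-1) ^+ j) *
       c v u (mmode a i%:Z w) (s1 - j.+1%:R - i%:R) (s2 + j%:R)).
Proof.
have [m0 hm0] := lio_iter_neg Y2 a 0 k v s2 u.
exists m0 => J /hm0 e0.
have [m1 hm1] := eventually_ord (fun j : 'I_J =>
  lio_iter_neg Y1 a j h (Y2 k v (s2 + j%:R) u) s1 w).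
exists m1 => I /hm1 e1; rewrite /c e0.
rewrite lio_suml raddf_sum [X in _ = _ + (_ + X)]exchange_big addrCA -!big_split /=.
apply: eq_bigr => j _.
rewrite addn0 binn scale1r expr0 scale1r lioDl raddfD /= addrC; congr (_ + _).
rewrite e1 raddf_sum -big_split /=; apply: eq_bigr => i _.
by rewrite linearZ /= raddfD /= linearZ /= mulrDr mulrA [(j + i)%N]addnC.
Qed.

(** The mode [a_{-1}] is commuted past the inner operator, and the resulting
    [a_{-1}] of an inner product is expanded by the outer iterate formula. *)
Lemma iterfam_expand2 (a : V) nv v u w s1 s2 :
  (forall j : nat, (nv <= j)%N -> mmode a j%:Z v = 0) ->
  exists m0 : nat, forall J, (m0 <= J)%N -> c v (mmode a (-1) u) w s1 s2 =
    \sum_(j < J) theta (mmode a (Negz j) (Y1 h (Y2 k v s2 u) (s1 + j%:R) w)) +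
    (\sum_(j < J) c v u (mmode a j%:Z w) (s1 - 1 - j%:R) s2 -
     \sum_(i < nv) (-1) ^+ i * c (mmode a i%:Z v) u w s1 (s2 - 1 - i%:R)).
Proof.
move=> v0; have [m0 hm0] := lio_iter_neg Y1 a 0 h (Y2 k v s2 u) s1 w.
exists m0 => J /hm0 e0; rewrite /c (lio_comm_neg _ 0 _ _ _ v0).
rewrite lioDl lioNl lio_suml raddfB e0 2!raddf_sum /= addrA -big_split /=.
congr (_ - _); apply: eq_bigr => j _.
  by rewrite addn0 binn scale1r expr0 scale1r raddfD.
by rewrite lioZl linearZ /= addn0 binn mulr1.
Qed.

(** The mode [a_{-1}] is commuted past the outer operator, and the nonnegative
    modes acting on the inner product are distributed over [v] and [u], which
    again produces [(y + z)^-(i+1)]. *)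
Lemma iterfam_expand3 (a : V) nv v u w s1 s2 :
  (forall j : nat, (nv <= j)%N -> mmode a j%:Z v = 0) ->
  exists m0 : nat, forall J, (m0 <= J)%N -> c v u (mmode a (-1) w) s1 s2 =
    theta (mmode a (Negz 0) (Y1 h (Y2 k v s2 u) s1 w)) +
    (\sum_(j < J) (-1) ^+ j.+1 * c v (mmode a j%:Z u) w (s1 - 1 - j%:R) s2 +
     \sum_(i < nv) \sum_(j < J) 'C(j, i)%:R * ((-1) ^+ j.+1 *
       c (mmode a i%:Z v) u w (s1 - 1 - j%:R) (s2 + j%:R - i%:R))).
Proof.
move=> v0; have [m0 hm0] := mmode_eventually0 a (Y2 k v s2 u).
exists m0 => J hJ; rewrite /c (@lio_comm_neg _ _ _ _ _ Y1 J a 0); last first.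
  by move=> j hj; apply: hm0; apply: leq_trans hj.
rewrite raddfB /= raddf_sum exchange_big -big_split /= -sumrN; congr (_ + _).
apply: eq_bigr => j _.
rewrite linearZ /= (lio_comm_nat _ _ _ _ _ v0) lioDl lio_suml /= raddfD /= raddf_sum /=.
rewrite addn0 binn mulr1 -mulNr -[- _]mulN1r -exprS mulrDr mulr_sumr; congr (_ + _).
by apply: eq_bigr => i _; rewrite lioZl linearZ /= mulrCA.
Qed.

Lemma iterfam_deriv2 v u w s1 s2 : c (mmode (vconf V) 0 v) u w s1 s2 =
  - s2 * c v u w s1 (s2 - 1) + k.+1%:R * theta (Y1 h (Y2 k.+1 v (s2 - 1) u) s1 w).
Proof. by rewrite /c lio_deriv lioDl !lioZl raddfD /= !linearZ /=. Qed.

(** The derivative in [y] is the translation of the inner product, which by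
    [lio_translation] acts on [v] and [u]. *)
Lemma iterfam_deriv1 v u w s1 s2 :
  c (mmode (vconf V) 0 v) u w s1 s2 + c v (mmode (vconf V) 0 u) w s1 s2 =
  - s1 * c v u w (s1 - 1) s2 + h.+1%:R * theta (Y1 h.+1 (Y2 k v s2 u) (s1 - 1) w).
Proof.
by rewrite /c -raddfD -lioDl -lio_translation lio_deriv raddfD /= !linearZ /=.
Qed.

Section Relations.
Variable P : (CC -> CC -> CC) -> Prop.
Hypothesis hP : reg_closed (-1) P.

Section Modes.
Variables (d : nat) (a : V) (l m n : nat) (v : A) (u : B) (w : C).
Hypotheses (d0 : (0 < d)%N) (ha : vgr d%:Z a).
Hypotheses (gv : gA l v) (gu : gB m u) (gw : gC n w).
Let N := (l + m + n)%N.
Hypothesis bel : below gA gB gC F P (N + d).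

Let vj j := @mode_vanish _ _ _ _ hgA _ _ _ _ ha gv j.
Let uj j := @mode_vanish _ _ _ _ hgB _ _ _ _ ha gu j.
Let wj j := @mode_vanish _ _ _ _ hgC _ _ _ _ ha gw j.

Lemma iter_below1 (j : nat) : (j < l + d)%N ->
  P (twist (N + d - j.+1) (F (mmode a j%:Z v) u w)).
Proof.
move=> hj; apply: bel; first by rewrite /N; lia.
exists (l + d - j.+1)%N, m, n; split => //; last by rewrite /N; lia.
exact: (mode_homog hgA ha gv hj).
Qed.

Lemma iter_below2 (j : nat) : (j < m + d)%N ->
  P (twist (N + d - j.+1) (F v (mmode a j%:Z u) w)).
Proof.
move=> hj; apply: bel; first by rewrite /N; lia.
exists l, (m + d - j.+1)%N, n; split => //; last by rewrite /N; lia.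
exact: (mode_homog hgB ha gu hj).
Qed.

Lemma iter_below3 (j : nat) : (j < n + d)%N ->
  P (twist (N + d - j.+1) (F v u (mmode a j%:Z w))).
Proof.
move=> hj; apply: bel; first by rewrite /N; lia.
exists l, m, (n + d - j.+1)%N; split => //; last by rewrite /N; lia.
exact: (mode_homog hgC ha gw hj).
Qed.

Lemma iterfam_red1 : P (twist (N + d) (F (mmode a (-1) v) u w)).
Proof.
pose low (j : nat) := iterfam (theta \o mmode a (Negz j)) h k v u w.
pose x (i : nat) := twist (N + d - i.+1) (F v u (mmode a i%:Z w)).
have tx i : trunc (x i) by apply: trunc_twist; exact: iterfam_trunc.
rewrite (_ : twist _ _ = fun r b =>
  \sum_(j < M) \sum_(i < M) 'C(i + j, i)%:R *
    low (j + i)%N (r - (N + d)%:R - (i + j)%:R) (b - (N + d)%:R - j%:R) +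
  (\sum_(j < m + d) twist (N + d - j.+1) (F v (mmode a j%:Z u) w) r b +
   \sum_(i < n + d) invpow (-1) i (x i) r (b - i.+1%:R))); last first.
  apply/funext => r; apply/funext => b.
  pose b' := b - (N + d)%:R; pose r' := r - (N + d)%:R.
  have [m0 hm0] := @iterfam_expand1 a v u w (b' - r' - 1) (- b' - 1).
  have [m1 hm1] := eventually_ord
    (fun i : 'I_(n + d) => trunc_nat r (b - i.+1%:R) (tx i)).
  pose J := (m0 + M + (m + d) + m1)%N.
  have [|m2 hm2] := hm0 J; first by rewrite /J; lia.
  pose I := (m2 + M + (n + d))%N.
  rewrite [LHS](hm2 I) /c; last by rewrite /I; lia.
  congr (_ + (_ + _)).
  - rewrite (@sum_truncate _ (fun j : nat => \sum_(i < I) 'C(i + j, i)%:R *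
      theta (mmode a (Negz (j + i)) (Y1 h (Y2 k v (- b' - 1 + j%:R) u)
        (b' - r' - 1 + i%:R) w))) M) => [||j Mj]; first last.
    + by rewrite big1 // => i _; rewrite (theta_vanish _ d0 ha) ?mulr0 //; lia.
    + by rewrite /J; lia.
    apply: eq_bigr => j _.
    rewrite (@sum_truncate _ (fun i : nat => 'C(i + j, i)%:R *
      theta (mmode a (Negz (j + i)) (Y1 h (Y2 k v (- b' - 1 + j%:R) u)
        (b' - r' - 1 + i%:R) w))) M) => [||i Mi]; first last.
    + by rewrite (theta_vanish _ d0 ha) ?mulr0 //; lia.
    + by rewrite /I; lia.
    apply: eq_bigr => i _; rewrite /low /iterfam /=; congr (_ * _).
    by congr (theta (mmode _ _ (Y1 _ (Y2 _ _ _ _) _ _))); rewrite /b' /r' ?natrD; ring.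
  - rewrite (@sum_truncate _ (fun j : nat => theta (Y1 h (Y2 k v (- b' - 1 - 1 - j%:R)
      (mmode a j%:Z u)) (b' - r' - 1) w)) (m + d)) => [||j hj]; first last.
    + by rewrite uj // !raddf0 lio0l raddf0.
    + by rewrite /J; lia.
    apply: eq_bigr => -[j hj] _; rewrite /twist /F /iterfam /= natrB; last by lia.
    by congr (theta (Y1 _ (Y2 _ _ _ _) _ _)); rewrite /b' /r'; ring.
  - rewrite (@sum_truncate _ (fun i : nat => \sum_(j < J) ('C(j + i, i)%:R * (-1) ^+ j) *
      theta (Y1 h (Y2 k v (- b' - 1 + j%:R) u) (b' - r' - 1 - j.+1%:R - i%:R)
        (mmode a i%:Z w))) (n + d)) => [||i hi]; first last.
    + by rewrite big1 // => j _; rewrite wj // !raddf0 mulr0.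
    + by rewrite /I; lia.
    apply: eq_bigr => -[i hi] _.
    rewrite (@invpow_finite _ _ _ _ _ _ J) => [|j hj]; last first.
      by rewrite (hm1 _ _ (Ordinal hi)) //; move: hj; rewrite /J; lia.
    apply: eq_bigr => j _ /=; congr (_ * _).
    rewrite /x /twist /F /iterfam /= natrB; last by lia.
    by congr (theta (Y1 _ (Y2 _ _ _ _) _ _)); rewrite /b' /r'; ring.
apply: (rcD hP).
  apply: (rc_sum hP) => j; apply: (rc_sum hP) => i; apply: (rcZ hP).
  apply: (rc_good hP).
  have := good_shift ((N + d)%:R + (i + j)%:R) ((N + d)%:R + j%:R)
    (theta_low (j + i) v u w d0 ha).
  by congr good; apply/funext => r; apply/funext => b; rewrite !opprD !addrA.
apply: (rcD hP); apply: (rc_sum hP) => -[j hj]; first exact: iter_below2.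
apply: (rc_shiftn hP j.+1 (x := invpow (-1) j (x j))).
by apply: (rc_invpow hP) => //; exact: iter_below3.
Qed.

Lemma iterfam_red2 : P (twist (N + d) (F v (mmode a (-1) u) w)).
Proof.
pose low (j : nat) := iterfam (theta \o mmode a (Negz j)) h k v u w.
rewrite (_ : twist _ _ = fun r b =>
  \sum_(j < M) low j (r - (N + d)%:R - j%:R) (b - (N + d)%:R) +
  (\sum_(j < n + d) twist (N + d - j.+1) (F v u (mmode a j%:Z w)) r (b - j.+1%:R) -
   \sum_(i < l + d) (-1) ^+ i *
     twist (N + d - i.+1) (F (mmode a i%:Z v) u w) r b)); last first.
  apply/funext => r; apply/funext => b.
  pose b' := b - (N + d)%:R; pose r' := r - (N + d)%:R.
  have [m0 hm0] := @iterfam_expand2 a _ v u w (b' - r' - 1) (- b' - 1) vj.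
  pose J := (m0 + M + (n + d))%N.
  rewrite [LHS](hm0 J) /c; last by rewrite /J; lia.
  congr (_ + (_ - _)).
  - rewrite (@sum_truncate _ (fun j : nat => theta (mmode a (Negz j)
      (Y1 h (Y2 k v (- b' - 1) u) (b' - r' - 1 + j%:R) w))) M) => [||j Mj]; first last.
    + by rewrite (theta_vanish _ d0 ha).
    + by rewrite /J; lia.
    apply: eq_bigr => j _; rewrite /low /iterfam /=.
    by congr (theta (mmode _ _ (Y1 _ _ _ _))); rewrite /b' /r'; ring.
  - rewrite (@sum_truncate _ (fun j : nat => theta (Y1 h (Y2 k v (- b' - 1) u)
      (b' - r' - 1 - 1 - j%:R) (mmode a j%:Z w))) (n + d)) => [||j hj]; first last.
    + by rewrite wj // !raddf0.
    + by rewrite /J; lia.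
    apply: eq_bigr => -[j hj] _; rewrite /twist /F /iterfam /= natrB; last by lia.
    by congr (theta (Y1 _ (Y2 _ _ _ _) _ _)); rewrite /b' /r'; ring.
  - apply: eq_bigr => -[i hi] _; congr (_ * _).
    rewrite /twist /F /iterfam /= natrB; last by lia.
    by congr (theta (Y1 _ (Y2 _ _ _ _) _ _)); rewrite /b' /r'; ring.
apply: (rcD hP).
  apply: (rc_sum hP) => j; apply: (rc_good hP).
  have := good_shift ((N + d)%:R + j%:R) (N + d)%:R (theta_low j v u w d0 ha).
  by congr good; apply/funext => r; apply/funext => b; rewrite opprD addrA.
apply: (rcB hP); apply: (rc_sum hP) => -[j hj].
  by apply: (rc_shiftn hP j.+1); exact: iter_below3.
by apply: (rcZ hP); exact: iter_below1.
Qed.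

Lemma iterfam_red3 : P (twist (N + d) (F v u (mmode a (-1) w))).
Proof.
pose low := iterfam (theta \o mmode a (Negz 0)) h k v u w.
pose x (i : nat) := twist (N + d - i.+1) (F (mmode a i%:Z v) u w).
have tx i : trunc (x i) by apply: trunc_twist; exact: iterfam_trunc.
rewrite (_ : twist _ _ = fun r b => low (r - (N + d)%:R) (b - (N + d)%:R) +
  (\sum_(j < m + d) (-1) ^+ j.+1 *
      twist (N + d - j.+1) (F v (mmode a j%:Z u) w) r (b - j.+1%:R) +
   \sum_(i < l + d) (-1) ^+ i.+1 * invpow (-1) i (x i) r (b - i.+1%:R))); last first.
  apply/funext => r; apply/funext => b.
  pose b' := b - (N + d)%:R; pose r' := r - (N + d)%:R.
  have [m0 hm0] := @iterfam_expand3 a _ v u w (b' - r' - 1) (- b' - 1) vj.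
  have [m1 hm1] := eventually_ord
    (fun i : 'I_(l + d) => trunc_nat r (b - i.+1%:R) (tx i)).
  pose J := (m0 + (m + d) + (m1 + (l + d)))%N.
  rewrite [LHS](hm0 J) /c; last by rewrite /J; lia.
  congr (_ + (_ + _)).
  - rewrite (@sum_truncate _ (fun j : nat => (-1) ^+ j.+1 * theta (Y1 h
      (Y2 k v (- b' - 1) (mmode a j%:Z u)) (b' - r' - 1 - 1 - j%:R) w)) (m + d))
      => [||j hj]; first last.
    + by rewrite uj // !raddf0 lio0l raddf0 mulr0.
    + by rewrite /J; lia.
    apply: eq_bigr => -[j hj] _; congr (_ * _).
    rewrite /twist /F /iterfam /= natrB; last by lia.
    by congr (theta (Y1 _ (Y2 _ _ _ _) _ _)); rewrite /b' /r'; ring.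
  - apply: eq_bigr => -[i hi] _.
    rewrite (@invpow_finite _ _ _ _ _ _ (J - i)) => [|j hj]; last first.
      by rewrite (hm1 _ _ (Ordinal hi)) //; move: hj; rewrite /J; lia.
    rewrite (@sum_bin_shift _ (fun j : nat => (-1) ^+ j.+1 * theta (Y1 h
      (Y2 k (mmode a i%:Z v) (- b' - 1 + j%:R - i%:R) u) (b' - r' - 1 - 1 - j%:R) w)))
      /=; last by rewrite /J; lia.
    rewrite mulr_sumr; apply: eq_bigr => j _.
    rewrite (_ : theta _ = x i r (b - i.+1%:R - j%:R)).
      by rewrite /= -addnS exprD; ring.
    rewrite /x /twist /F /iterfam /= natrB; last by lia.
    by congr (theta (Y1 _ (Y2 _ _ _ _) _ _)); rewrite /b' /r' !natrD; ring.
apply: (rcD hP).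
  by apply: (rc_good hP); apply: good_shift; exact: (theta_low _ _ _ _ d0 ha).
apply: (rcD hP); apply: (rc_sum hP) => -[j hj]; apply: (rcZ hP).
  by apply: (rc_shiftn hP j.+1); exact: iter_below2.
apply: (rc_shiftn hP j.+1 (x := invpow (-1) j (x j))).
by apply: (rc_invpow hP) => //; exact: iter_below1.
Qed.

End Modes.

Section Derivatives.
Hypothesis bel : forall N, below gA gB gC F P N.
Variables (N : nat) (v : A) (u : B) (w : C).
Hypothesis hN : homog gA gB gC N v u w.

Lemma iterfam_L1 : P (twist N.+1 (F (mmode (vconf V) 0 v) u w)).
Proof.
have [l [m [n [gv gu gw NE]]]] := hN.
apply: (bel (N := N.+2)); first by [].
exists l.+1, m, n; split => //; last by rewrite NE; lia.
by apply: (homog_mode hgA (vgr_conf V) gv); lia.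
Qed.

Lemma iterfam_L2 : P (twist N.+1 (F v (mmode (vconf V) 0 u) w)).
Proof.
have [l [m [n [gv gu gw NE]]]] := hN.
apply: (bel (N := N.+2)); first by [].
exists l, m.+1, n; split => //; last by rewrite NE; lia.
by apply: (homog_mode hgB (vgr_conf V) gu); lia.
Qed.

Lemma iterfam_small : P (fun r b => b * twist N (F v u w) r b).
Proof.
rewrite (_ : (fun r b => _) = fun r b => N%:R * twist N (F v u w) r b +
  (twist N.+1 (F (mmode (vconf V) 0 v) u w) r b -
   k.+1%:R * twist N (iterfam theta h k.+1 v u w) r b)); last first.
  apply/funext => r; apply/funext => b.
  rewrite [X in _ + (X - _)]iterfam_deriv2 /c /twist /F /iterfam.
  have e1 : b - N.+1%:R - (r - N.+1%:R) - 1 = b - N%:R - (r - N%:R) - 1 by ring.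
  have e2 : - (b - N.+1%:R) - 1 - 1 = - (b - N%:R) - 1 by ring.
  by rewrite e1 e2; ring.
apply: (rcD hP); first by apply: (rcZ hP); apply: (bel (N := N.+1)).
apply: (rcB hP); first exact: iterfam_L1.
by apply: (rcZ hP); apply: (rc_good hP); exact: good_shift.
Qed.

Lemma iterfam_total : P (fun r b => r * twist N (F v u w) r (b - 1)).
Proof.
rewrite (_ : (fun r b => _) = fun r b => (b - 1) * twist N (F v u w) r (b - 1) +
  (twist N.+1 (F (mmode (vconf V) 0 v) u w) r b +
   twist N.+1 (F v (mmode (vconf V) 0 u) w) r b -
   h.+1%:R * twist N (iterfam theta h.+1 k v u w) r (b - 1))); last first.
  apply/funext => r; apply/funext => b.
  rewrite [X in _ + (X - _)]iterfam_deriv1 /c /twist /F /iterfam.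
  have e1 : b - N.+1%:R - (r - N.+1%:R) - 1 - 1 = b - 1 - N%:R - (r - N%:R) - 1.
    by ring.
  have e2 : - (b - N.+1%:R) - 1 = - (b - 1 - N%:R) - 1 by ring.
  by rewrite e1 e2; ring.
apply: (rcD hP); first exact: (rc_shift hP iterfam_small).
apply: (rcB hP); first by apply: (rcD hP); [exact: iterfam_L1 | exact: iterfam_L2].
apply: (rcZ hP).
apply: (rc_shift hP (x := twist N (iterfam theta h.+1 k v u w))).
by apply: (rc_good hP); exact: good_shift.
Qed.

End Derivatives.
End Relations.

Lemma iterfam_reducible : reducible gA gB gC (-1) F.
Proof.
split.
- by move=> a v v' u w r b; rewrite /F /iterfam !lio_linl linearP.
- by move=> a v u u' w r b; rewrite /F /iterfam linearP lio_linl linearP.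
- by move=> a v u w w' r b; rewrite /F /iterfam !linearP.
- exact: iterfam_trunc.
- move=> P hP d a N v u w d0 ha [l [m [n [gv gu gw ->]]]] bel.
  exact: iterfam_red1.
- move=> P hP d a N v u w d0 ha [l [m [n [gv gu gw ->]]]] bel.
  exact: iterfam_red2.
- move=> P hP d a N v u w d0 ha [l [m [n [gv gu gw ->]]]] bel.
  exact: iterfam_red3.
- by move=> P hP bel N v u w hN; exact: iterfam_small.
- by move=> P hP bel N v u w hN; exact: iterfam_total.
Qed.

End Iterate.

(** * Induction on the linear form and on the logarithms *)

Section LowerTerms.
Variables (R : realType) (V : voa R) (D : vmodule V) (g : nat -> set D).
Hypothesis hg : is_grading g.

Lemma vanish_on_grading (theta : {scalar D}) :
  (forall m x, g m x -> theta x = 0) -> forall x, theta x = 0.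
Proof.
move=> h x; have [L hL ->] := pieces_homog hg.1 x.
by rewrite raddf_sum big_seq big1 //= => p /hL /h.
Qed.

(** As [mmode a (Negz n)] raises degrees by at least [n + 1] when [a] has
    positive weight, composing [theta] with it lowers the degree from which
    [theta] vanishes; the powers of the logarithms are treated by descending
    induction. *)
Lemma contragredient_log_ind (G : {scalar D} -> nat -> nat -> Prop) (K1 K2 : nat) :
  (forall (theta : {scalar D}) h k, (forall x, theta x = 0) -> G theta h k) ->
  (forall (theta : {scalar D}) h k, (K1 < h)%N -> G theta h k) ->
  (forall (theta : {scalar D}) h k, (K2 < k)%N -> G theta h k) ->
  (forall (theta : {scalar D}) h k M,
    (forall (d : nat) (a : V) n, (0 < d)%N -> vgr d%:Z a ->
      G (theta \o mmode a (Negz n)) h k) ->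
    (forall (d : nat) (a : V) n x, (0 < d)%N -> vgr d%:Z a -> (M <= n)%N ->
      theta (mmode a (Negz n) x) = 0) ->
    G theta h.+1 k -> G theta h k.+1 -> G theta h k) ->
  forall theta, contragredient g theta -> forall h k, G theta h k.
Proof.
move=> G0 GK1 GK2 step theta [M]; elim: M theta => [|M IH] theta hM h k.
  by apply: G0; apply: vanish_on_grading => m x gx; exact: hM gx.
have [n] : exists n, (K1 + K2 + 2 <= h + k + n)%N by exists (K1 + K2 + 2)%N; lia.
elim: n h k => [|n IHn] h k hk.
  have [hK|Kh] := leqP h K1; last exact: GK1.
  by apply: GK2; lia.
have deg (d : nat) (a : V) j m x : vgr d%:Z a -> g m x ->
    g (m + d + j)%N (mmode a (Negz j) x).
  by move=> ha gx; apply: (homog_mode hg ha gx); lia.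
apply: (step _ _ _ M.+1).
- move=> d a j d0 ha; apply: IH => m x hm gx /=.
  by apply: hM (deg _ _ j _ _ ha gx); lia.
- move=> d a j x d0 ha hj.
  apply: (vanish_on_grading (theta := theta \o mmode a (Negz j))) => m y gy /=.
  by apply: hM (deg _ _ j _ _ ha gy); lia.
- by apply: IHn; lia.
- by apply: IHn; lia.
Qed.

End LowerTerms.

Section Correlators.
Variables (R : realType) (V : voa R) (A B C : vmodule V).
Hypotheses (gradA : N_gradable A) (gradB : N_gradable B) (gradC : N_gradable C).
Hypotheses (cofA : C1_cofinite A) (cofB : C1_cofinite B) (cofC : C1_cofinite C).

Lemma normc_nat1 : Normc.normc (1 : R[i]) <= 1.
Proof. by rewrite Normc.normc1. Qed.

Theorem prodfam_good (BC D : vmodule V) (Y1 : log_intertwiner A BC D)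
    (Y2 : log_intertwiner B C BC) (g : nat -> set D) (theta : {scalar D}) :
  is_grading g -> contragredient g theta ->
  forall h k v u w, good (prodfam Y1 Y2 theta h k v u w).
Proof.
move=> hg; have [gA hgA] := gradA; have [gB hgB] := gradB; have [gC hgC] := gradC.
have [K1 hK1] := lio_log Y1; have [K2 hK2] := lio_log Y2.
have zero x : (forall r b, x r b = 0) -> good (R := R) x.
  move=> hx; rewrite (_ : x = fun _ _ => 0); first exact: good0.
  by apply/funext => r; apply/funext => b.
apply: (contragredient_log_ind hg (K1 := K1) (K2 := K2)
  (G := fun theta h k => forall v u w, good (prodfam Y1 Y2 theta h k v u w))).
- by move=> t h k t0 v u w; apply: zero => r b; rewrite /prodfam t0.
- by move=> t h k hK v u w; apply: zero => r b; rewrite /prodfam hK1 ?raddf0.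
- by move=> t h k hK v u w; apply: zero => r b; rewrite /prodfam hK2 ?raddf0 ?raddf0.
- move=> t h k M low van l1 l2.
  apply: (reducible_good (s := 1) hgA hgB hgC cofA cofB cofC normc_nat1).
    by rewrite mul1r -opprB oppr_eq0 (_ : 2 - 1 = 1) ?oner_eq0 //; ring.
  apply: (@prodfam_reducible _ _ _ _ _ _ _ Y1 Y2 gA gB gC hgA hgB hgC t h k M) => //.
    by move=> d a n v u w d0 ha; exact: (low d a n d0 ha).
Qed.

Theorem iterfam_good (AB D : vmodule V) (Y1 : log_intertwiner AB C D)
    (Y2 : log_intertwiner A B AB) (g : nat -> set D) (theta : {scalar D}) :
  is_grading g -> contragredient g theta ->
  forall h k v u w, good (iterfam Y1 Y2 theta h k v u w).
Proof.
move=> hg; have [gA hgA] := gradA; have [gB hgB] := gradB; have [gC hgC] := gradC.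
have [K1 hK1] := lio_log Y1; have [K2 hK2] := lio_log Y2.
have zero x : (forall r b, x r b = 0) -> good (R := R) x.
  move=> hx; rewrite (_ : x = fun _ _ => 0); first exact: good0.
  by apply/funext => r; apply/funext => b.
apply: (contragredient_log_ind hg (K1 := K1) (K2 := K2)
  (G := fun theta h k => forall v u w, good (iterfam Y1 Y2 theta h k v u w))).
- by move=> t h k t0 v u w; apply: zero => r b; rewrite /iterfam t0.
- by move=> t h k hK v u w; apply: zero => r b; rewrite /iterfam hK1 ?raddf0.
- by move=> t h k hK v u w; apply: zero => r b; rewrite /iterfam hK2 ?lio0l ?raddf0.
- move=> t h k M low van l1 l2.
  apply: (reducible_good (s := -1) hgA hgB hgC cofA cofB cofC).
  + by rewrite normcN; exact: normc_nat1.
  + by rewrite mulN1r opprK (_ : 1 + 2 = 3%:R) ?pnatr_eq0 //; ring.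
  apply: (@iterfam_reducible _ _ _ _ _ _ _ Y1 Y2 gA gB gC hgA hgB hgC t h k M) => //.
    by move=> d a n v u w d0 ha; exact: (low d a n d0 ha).
Qed.

End Correlators.

(** * Normal convergence *)

Section Convergence.
Variable R : realType.
Local Notation CC := (R[i])^o.
Local Notation C2 := (CC * CC)%type.
Local Notation normc := (@Normc.normc R).
Local Notation Re := (@complex.Re R).

Lemma normc_cexp (z : R[i]) : normc (cexp z) = expR (Re z).
Proof.
rewrite /cexp Normc.normcM /= expr0n addr0 sqrtr_sqr ger0_norm ?expR_ge0 //.
by rewrite cos2Dsin2 sqrtr1 mulr1.
Qed.

Lemma normE (z : CC) : `|z| = (normc z)%:C.
Proof. by rewrite normc_def; case: z. Qed.

Lemma near_normc (l : C2 -> CC) (p : C2) (e : R) : {for p, continuous l} ->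
  0 < e -> \forall q \near p, normc (l q - l p) < e.
Proof.
move=> lc e0; have e0' : (0 : R[i]) < e%:C by rewrite ltcR.
have /cvgrPdist_lt/(_ _ e0') := lc; apply: filterS => q.
by rewrite normE ltcR -opprB normcN.
Qed.

Lemma esum_geometric (J : choiceType) (S : set J) (nu : J -> nat) (T q : R) :
  set_inj S nu -> 0 <= T -> 0 < q < 1 ->
  (\esum_(j in S) (T * q ^+ nu j)%:E < +oo)%E.
Proof.
move=> inj T0 /andP[q0 q1].
rewrite -(esum_image S nu (fun n => (T * q ^+ n)%:E) inj).
have pos n : (0 <= (T * q ^+ n)%:E)%E by rewrite lee_fin mulr_ge0 ?exprn_ge0 // ltW.
apply: (@le_lt_trans _ _ (\esum_(n in [set: nat]) (T * q ^+ n)%:E)%E).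
  rewrite esum_mkcond; apply: le_esum => n _; case: ifP => // _.
rewrite -nneseries_esumT //.
apply: (@le_lt_trans _ _ (T * (1 - q)^-1)%:E); last exact: ltry.
apply: lime_le; first by apply: is_cvg_nneseries => n _ _; exact: pos.
apply: nearW => n; rewrite sumEFin lee_fin.
by apply: (geometric_le_lim n T0 q0); rewrite ger0_norm // ltW.
Qed.

(** Near [p] the ratio of the monomials [small^b] and [large^b] decays like
    [expR (- 2 * e * n)] along [b = b0 + n], where [e] is a quarter of the
    difference of the real parts of the logarithms at [p], and the coefficients
    grow at most like [expR (e * n)]; this leaves finitely many geometric series
    of ratio [expR (- e)]. *)
Lemma good_normally_convergent (J : choiceType) (x : R[i] -> R[i] -> R[i])
    (lg sm : J -> R[i]) (p : C2) (lL lS : C2 -> CC) :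
  good x -> (forall i j, lg i = lg j -> sm i = sm j -> i = j) ->
  {for p, continuous lL} -> {for p, continuous lS} -> Re (lS p) < Re (lL p) ->
  exists2 U : set C2, nbhs p U & normally_convergent U (fun j q =>
    x (lg j + sm j) (sm j) * cexp (lg j * lL q) * cexp (sm j * lS q)).
Proof.
move=> [[rs hr] [bs hb] hg] inj cL cS lt_SL.
pose e := (Re (lL p) - Re (lS p)) / 4.
have e0 : 0 < e by rewrite divr_gt0 ?subr_gt0.
have [K0 hK0] := hg _ e0; pose K := Num.max 0 K0.
have K_ge0 : 0 <= K by rewrite le_max lexx.
have hK r b : normc (x r b) <= K * expR (e * Re b).
  by apply: (le_trans (hK0 r b)); rewrite ler_wpM2r ?expR_ge0 // le_max lexx orbT.
pose L := normc (lL p) + normc (lS p) + e *+ 2.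
exists [set q | normc (lL q - lL p) < e /\ normc (lS q - lS p) < e].
  by apply: filterI; exact: near_normc.
rewrite /normally_convergent; set U := [set q | _].
have hU q : U q -> [/\ normc (lL q) <= L, normc (lS q - lL q) <= L &
    Re (lS q - lL q) <= - (e *+ 2)].
  move=> [h1 h2].
  have E1 : lL q = lL p + (lL q - lL p) by rewrite addrC subrK.
  have E2 : lS q - lL q = (lS q - lS p) - (lL q - lL p) + (lS p - lL p).
    by ring.
  have n1 := normc_ge0 (lL p); have n2 := normc_ge0 (lS p); split.
  - have := le_normcD (lL p) (lL q - lL p); rewrite -E1 /L => /le_trans; apply.
    by lra.
  - rewrite E2; apply: (le_trans (le_normcD _ _)).
    have := le_normcD (lS q - lS p) (- (lL q - lL p)).
    have := le_normcD (lS p) (- lL p).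
    by rewrite !normcN /L; lra.
  - rewrite E2 !(ReD, ReN).
    have := ler_Re_normc (lS q - lS p).
    have := ler_Re_normc (- (lL q - lL p)); rewrite normcN !(ReD, ReN).
    by rewrite /e in h1 h2 *; lra.
pose q0 := expR (- e).
have q01 : 0 < q0 < 1 by rewrite expR_gt0 expR_lt1 oppr_lt0.
pose T (rb : R[i] * R[i]) :=
  K * expR (e * Re rb.2 + normc rb.1 * L + normc rb.2 * L).
pose nu (rb : R[i] * R[i]) j := Num.Def.truncn (Re (sm j - rb.2)).
pose S (rb : R[i] * R[i]) : set J :=
  [set j | lg j + sm j = rb.1 /\ exists n : nat, sm j = rb.2 + n%:R].
have nuE rb j (n : nat) : sm j = rb.2 + n%:R -> nu rb j = n.
  by move=> h; rewrite /nu h addrAC subrr add0r Re_nat natrK.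
pose rbs := [seq (r, b) | r <- rs, b <- bs].
pose t rb j := if j \in S rb then (T rb * q0 ^+ nu rb j)%:E else 0%E.
have T0 rb : 0 <= T rb by rewrite mulr_ge0 ?expR_ge0.
have t0 rb j : (0 <= t rb j)%E.
  rewrite /t; case: ifP => // _.
  by rewrite lee_fin mulr_ge0 // exprn_ge0 ?expR_ge0.
apply: (@le_lt_trans _ _ (\esum_(j in [set: J]) \sum_(rb <- rbs) t rb j)%E); last first.
  rewrite esum_sum //; apply: lte_sum_pinfty => rb _.
  rewrite /t -esum_mkcond; apply: esum_geometric => //.
  move=> i j; rewrite !inE => -[ri [n bi]] [rj [m bj]].
  rewrite (nuE _ _ _ bi) (nuE _ _ _ bj) => nm.
  have sij : sm i = sm j by rewrite bi bj nm.
  by apply: inj => //; apply: (addIr (sm i)); rewrite ri sij rj.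
apply: le_esum => j _; apply: ge_ereal_sup => _ [q /hU [bL bD bR] <-].
have [x0|/eqP xn] := eqVneq (x (lg j + sm j) (sm j)) 0.
  by rewrite x0 !mul0r Normc.normc0 sume_ge0.
have rj := hr _ _ xn; have [b0 [n [hb0 bE]]] := hb _ _ xn.
pose rb := (lg j + sm j, b0).
have rbL : rb \in rbs by apply/allpairsP; exists rb.
apply: (@le_trans _ _ (t rb j)); last first.
  by rewrite (big_rem rb) //= leeDl // sume_ge0.
have jS : j \in S rb by rewrite inE; split => //; exists n.
rewrite /t jS lee_fin (nuE rb j n bE) 2!Normc.normcM !normc_cexp -mulrA -expRD.
rewrite /T /= /q0 -expRM_natl -mulrA -expRD.
apply: (le_trans (ler_wpM2r (expR_ge0 _) (hK _ _))).
rewrite -mulrA -expRD ler_wpM2l // ler_expR -ReD.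
have -> : lg j * lL q + sm j * lS q =
    (lg j + sm j) * lL q + b0 * (lS q - lL q) + n%:R * (lS q - lL q).
  by rewrite bE; ring.
rewrite !ReD bE ReD Re_nat.
have ReM (z w : R[i]) : Re (z * w) <= normc z * normc w.
  by rewrite -Normc.normcM ler_Re_normc.
have h1 : Re ((lg j + (b0 + n%:R)) * lL q) <= normc (lg j + (b0 + n%:R)) * L.
  by apply: (le_trans (ReM _ _)); rewrite ler_wpM2l ?normc_ge0.
have h2 : Re (b0 * (lS q - lL q)) <= normc b0 * L.
  by apply: (le_trans (ReM _ _)); rewrite ler_wpM2l ?normc_ge0.
have h3 : Re (n%:R * (lS q - lL q)) <= n%:R * - (e *+ 2).
  have -> : Re (n%:R * (lS q - lL q)) = n%:R * Re (lS q - lL q).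
    elim: n {bE jS h1} => [|m IH]; first by rewrite !mul0r.
    by rewrite -!natr1 !mulrDl !mul1r ReD IH.
  by rewrite ler_wpM2l.
by rewrite /rb /= ?bE; lra.
Qed.

Lemma log_branch_at (X : C2 -> CC) p l : log_branch X p l ->
  cexp (l p) = X p /\ {for p, continuous l}.
Proof. exact: nbhs_singleton. Qed.

Lemma ltr_Re_cexp (y z : CC) : `|cexp y : CC| < `|cexp z : CC| -> Re y < Re z.
Proof. by rewrite !normE !normc_cexp ltcR ltr_expR. Qed.

End Convergence.

Theorem corollary3p3 (R : realType) (V : voa R) (A B C : vmodule V)
  (gradA : N_gradable A) (gradB : N_gradable B) (gradC : N_gradable C)
  (cofA : C1_cofinite A) (cofB : C1_cofinite B) (cofC : C1_cofinite C)
  (BC : vmodule V) (Y_BC : log_intertwiner B C BC)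
  (fusBC : is_fusion_product Y_BC)
  (A_BC : vmodule V) (Y_A_BC : log_intertwiner A BC A_BC)
  (fusA_BC : is_fusion_product Y_A_BC)
  (AB : vmodule V) (Y_AB : log_intertwiner A B AB)
  (fusAB : is_fusion_product Y_AB)
  (AB_C : vmodule V) (Y_AB_C : log_intertwiner AB C AB_C)
  (fusAB_C : is_fusion_product Y_AB_C)
  (g : nat -> set A_BC) (gP : is_grading g)
  (g' : nat -> set AB_C) (g'P : is_grading g')
  (theta : {scalar A_BC}) (thetaP : contragredient g theta)
  (theta' : {scalar AB_C}) (theta'P : contragredient g' theta')
  (v : A) (u : B) (w : C) (h k : nat) :
  locally_normally_convergent (F_product Y_A_BC Y_BC h k theta v u w)
    (fun p => p.1) (fun p => p.2)
    [set p | 0 < `|p.2| /\ `|p.2| < `|p.1|] /\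
  locally_normally_convergent (F_iterate Y_AB_C Y_AB h k theta' v u w)
    (fun p => p.1 - p.2) (fun p => p.2)
    [set p | 0 < `|p.1 - p.2| /\ `|p.1 - p.2| < `|p.2|].
Proof.
split=> p lX lY [_ ltYX] hX hY.
- have [eX cX] := log_branch_at hX; have [eY cY] := log_branch_at hY.
  have lt_re : complex.Re (lY p) < complex.Re (lX p).
    by apply: ltr_Re_cexp; rewrite eX eY.
  have gd := prodfam_good gradA gradB gradC cofA cofB cofC Y_A_BC Y_BC gP thetaP h k v u w.
  have [|U pU nU] := good_normally_convergent (lg := fst) (sm := snd) gd _ cX cY lt_re.
    by move=> [a b] [a' b'] /= -> ->.
  exists U => //; move: nU; congr normally_convergent.
  apply/funext => -[a b]; apply/funext => q /=; congr (_ * _ * _).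
  by rewrite /prodfam /F_product; congr (theta (Y_A_BC _ _ _ _)); ring.
- have [eX cX] := log_branch_at hX; have [eY cY] := log_branch_at hY.
  have lt_re : complex.Re (lX p) < complex.Re (lY p).
    by apply: ltr_Re_cexp; rewrite eX eY.
  have gd := iterfam_good gradA gradB gradC cofA cofB cofC Y_AB_C Y_AB g'P theta'P h k v u w.
  have [|U pU nU] := good_normally_convergent (lg := snd) (sm := fst) gd _ cY cX lt_re.
    by move=> [a b] [a' b'] /= -> ->.
  exists U => //; move: nU; congr normally_convergent.
  apply/funext => -[a b]; apply/funext => q /=; rewrite mulrAC; congr (_ * _ * _).
  by rewrite /iterfam /F_iterate; congr (theta' (Y_AB_C _ _ _ _)); ring.
Qed.
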